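(* Let $d\in\mathbb{N}$ and let $X$ be a closed infinite-dimensional subspace of $L_1(\mathbb{R}^d)$. Let $\{f_i,f_i'\}_{i\in\mathbb{N}}\subseteq X\times X'$ be an unconditional approximate Schauder frame of translates for $X$ by a relatively uniformly separated sequence. Then the operator $$\Psi_1(g)=(f_i'(g))_{i\in\mathbb{N}}\qquad\text{for } g\in X$$ is an isomorphism between $X$ and a complemented subspace of $\ell_1$. In particular, $X$ is isomorphic to $\ell_1$.
   Context: Scalars are $\mathbb{K}\in\{\mathbb{R},\mathbb{C}\}$; $X'$ denotes the dual of $X$; an isomorphism is a bounded linear bijection with bounded inverse. For $\lambda\in\mathbb{R}^d$, $(T_\lambda f)(x)=f(x-\lambda)$. A sequence $\{f_i,f_i'\}_{i\in\mathbb{N}}\subseteq X\times X'$ is an approximate Schauder frame for $X$ if $S(g)=\sum_{i=1}^\infty f_i'(g)f_i$ ($g\in X$) defines an isomorphism $S:X\to X$; it is unconditional if the series converges unconditionally for each $g\in X$. Given a finite family $\{g_k\}_{1\le k\le k_0}\subset L_1(\mathbb{R}^d)$ of different, nonzero functions and a sequence $\{\lambda_i\}_{i\in\mathbb{N}}\subset\mathbb{R}^d$, a sequence $\{f_i\}_{i\in\mathbb{N}}$ is a sequence of translates of $\{g_k\}_{1\le k\le k_0}$ by $\{\lambda_i\}_{i\in\mathbb{N}}$ if for each $i$ there is $1\le k\le k_0$ with $f_i=T_{\lambda_i}g_k$. An approximate Schauder frame $\{f_i,f_i'\}_{i\in\mathbb{N}}$ for $X$ is an approximate Schauder frame of translates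 by $\{\lambda_i\}_{i\in\mathbb{N}}$ if $\{f_i\}_{i\in\mathbb{N}}$ is a sequence of translates of finitely many such functions by $\{\lambda_i\}_{i\in\mathbb{N}}$. An indexed family $\{\lambda_i\}_{i\in\Delta}\subseteq\mathbb{R}^d$ is uniformly separated if there is $\delta>0$ with $|\lambda_i-\lambda_{i'}|\ge\delta$ for all $i\neq i'$ in $\Delta$. It is relatively uniformly separated if there is a finite partition $\{\Delta_k\}_{1\le k\le m}$ of $\Delta$ such that $\{\lambda_i\}_{i\in\Delta_k}$ is uniformly separated for all $1\le k\le m$. *)

(* Defs.v *)
From HB Require Import structures.
From mathcomp Require Import all_boot all_order all_algebra complex.
From mathcomp Require Import all_classical all_reals all_analysis measurable_realfun.
Import numFieldNormedType.Exports.

Set Implicit Arguments.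
Unset Strict Implicit.
Unset Printing Implicit Defensive.
Import Order.TTheory GRing.Theory Num.Theory.
Local Open Scope classical_set_scope.
Local Open Scope ring_scope.

Inductive scalars := RealScalars | ComplexScalars.

Definition scal (R : realType) (s : scalars) : numFieldType :=
  match s with
  | RealScalars => R : numFieldType
  | ComplexScalars => R[i] : numFieldType
  end.

Definition scal_re {R : realType} {s : scalars} : scal R s -> R :=
  match s return scal R s -> R with
  | RealScalars => id
  | ComplexScalars => @complex.Re R
  end.

Definition scal_im {R : realType} {s : scalars} : scal R s -> R :=
  match s return scal R s -> R with
  | RealScalars => fun=> 0
  | ComplexScalars => @complex.Im R
  end.

Definition scal_real {R : realType} {s : scalars} : R -> scal R s :=
  match s return R -> scal R s with
  | RealScalars => id
  | ComplexScalars => real_complex R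
  end.

(* The norm of a numFieldType takes its values in the field itself; integrals
   and sums need the real-valued absolute value. *)
Definition modulus {R : realType} {s : scalars} (z : scal R s) : R :=
  Num.sqrt (scal_re z ^+ 2 + scal_im z ^+ 2).

Section scal_theory.
Context {R : realType} {s : scalars}.
Implicit Types (z w : scal R s) (a b : R).

Lemma scal_reD z w : scal_re (z + w) = scal_re z + scal_re w.
Proof. by case: s z w => [//|[? ?] [? ?]]. Qed.

Lemma scal_imD z w : scal_im (z + w) = scal_im z + scal_im w.
Proof. by case: s z w => [z w|[? ?] [? ?]] //=; rewrite addr0. Qed.

Lemma scal_reM z w :
  scal_re (z * w) = scal_re z * scal_re w - scal_im z * scal_im w.
Proof. by case: s z w => [z w|[? ?] [? ?]] //=; rewrite mul0r subr0. Qed.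

Lemma scal_imM z w :
  scal_im (z * w) = scal_re z * scal_im w + scal_im z * scal_re w.
Proof. by case: s z w => [z w|[? ?] [? ?]] //=; rewrite mulr0 mul0r addr0. Qed.

Lemma scal_re0 : scal_re (0 : scal R s) = 0.
Proof. by case: s. Qed.

Lemma scal_im0 : scal_im (0 : scal R s) = 0.
Proof. by case: s. Qed.

Lemma scal_realD a b : scal_real (a + b) = scal_real a + scal_real b :> scal R s.
Proof. by case: s => //=; exact: rmorphD. Qed.

Lemma scal_realM a b : scal_real (a * b) = scal_real a * scal_real b :> scal R s.
Proof. by case: s => //=; exact: rmorphM. Qed.

Lemma ler_scal_real a b : (scal_real a <= scal_real b :> scal R s) = (a <= b).
Proof. by case: s => //=; rewrite lecR. Qed.

Lemma scal_real_inj : injective (scal_real : R -> scal R s).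
Proof. by case: s => //= a b []. Qed.

Lemma norm_scal z : `|z| = scal_real (modulus z).
Proof.
rewrite /modulus; case: s z => [z|z] /=; last by rewrite normc_def.
by rewrite expr0n/= addr0 sqrtr_sqr.
Qed.

Lemma modulus_ge0 z : 0 <= modulus z.
Proof. exact: sqrtr_ge0. Qed.

Lemma modulus0 : modulus (0 : scal R s) = 0.
Proof. by rewrite /modulus scal_re0 scal_im0 expr0n/= addr0 sqrtr0. Qed.

Lemma modulus_eq0 z : modulus z = 0 -> z = 0.
Proof.
move=> z0; apply/normr0_eq0; rewrite norm_scal z0 -modulus0 -norm_scal.
exact: normr0.
Qed.

Lemma modulusD z w : modulus (z + w) <= modulus z + modulus w.
Proof. by rewrite -ler_scal_real scal_realD -!norm_scal ler_normD. Qed.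

Lemma modulusM z w : modulus (z * w) = modulus z * modulus w.
Proof. by apply: scal_real_inj; rewrite scal_realM -!norm_scal normrM. Qed.

Lemma modulus_le z : modulus z <= `|scal_re z| + `|scal_im z|.
Proof.
rewrite -[leRHS]ger0_norm ?addr_ge0// -sqrtr_sqr ler_wsqrtr// sqrrD.
rewrite !real_normK ?num_real//.
by rewrite lerD2r lerDl mulrn_wge0// mulr_ge0.
Qed.

End scal_theory.

Section measurable_rV.
Context {R : realType} (d : nat).

Let coord : 'I_d -> 'rV[R]_d -> measurableTypeR R := fun i x => x 0 i.

Let rV_set0 : g_sigma_preimage coord set0.
Proof. exact: sigma_algebra0. Qed.

Let rV_setC A : g_sigma_preimage coord A -> g_sigma_preimage coord (~` A).
Proof. exact: sigma_algebraC. Qed.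

Let rV_bigcup (F : _^nat) : (forall i, g_sigma_preimage coord (F i)) ->
  g_sigma_preimage coord (\bigcup_i (F i)).
Proof. exact: sigma_algebra_bigcup. Qed.

HB.instance Definition _ := @isMeasurable.Build default_measure_display
  'rV[R]_d (g_sigma_preimage coord) rV_set0 rV_setC rV_bigcup.

Lemma measurable_fun_rV d1 (T : measurableType d1) (f : T -> 'rV[R]_d) :
  (forall i, measurable_fun [set: T] (fun x => f x 0 i : measurableTypeR R)) ->
  measurable_fun [set: T] f.
Proof.
move=> mf _ A mA; rewrite setTI.
suff : g_sigma_preimage (fun i => coord i \o f) `<=` measurable.
  by apply; rewrite g_sigma_preimage_comp; exists A; rewrite ?setTI.
apply: smallest_sub; first exact: sigma_algebra_measurable.
elim/big_ind : _ => [//|B C hB hC|i _ B [C mC <-]].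
- by rewrite subUset.
- by have := mf i measurableT _ mC; rewrite setTI.
Qed.

Lemma measurable_coord (i : 'I_d) :
  measurable_fun [set: 'rV[R]_d] (fun x => x 0 i : measurableTypeR R).
Proof.
move=> _ Y mY; rewrite setTI; apply: sub_sigma_algebra => /=.
rewrite -bigcup_seq/=; exists i => /=; first by rewrite mem_index_enum.
by exists Y => //; rewrite setTI.
Qed.

End measurable_rV.

Section lebesgue_rV.
Context {R : realType}.

Definition cons_rV d (p : measurableTypeR R * 'rV[R]_d) : 'rV[R]_d.+1 :=
  \row_i oapp (fun j => p.2 0 j) p.1 (unlift ord0 i).

Lemma measurable_cons_rV d : measurable_fun setT (@cons_rV d).
Proof.
apply: measurable_fun_rV => i.
under eq_fun do rewrite mxE.
case: unliftP => [j|] _ /=; last exact: measurable_fst.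
by apply: (measurableT_comp (measurable_coord j)); exact: measurable_snd.
Qed.

Definition lebesgue_cons d
    (m : {sigma_finite_measure set 'rV[R]_d -> \bar R}) :=
  pushforward (@lebesgue_measure R \x m)%E (@cons_rV d).

Section lebesgue_cons.
Variables (d : nat) (m : {sigma_finite_measure set 'rV[R]_d -> \bar R}).

Let lebesgue_cons0 : lebesgue_cons m set0 = 0%E.
Proof. by rewrite /lebesgue_cons /pushforward preimage_set0 measure0. Qed.

Let lebesgue_cons_ge0 A : (0 <= lebesgue_cons m A)%E.
Proof. by rewrite /lebesgue_cons /pushforward; exact: measure_ge0. Qed.

Let lebesgue_cons_sigma_additive : semi_sigma_additive (lebesgue_cons m).
Proof.
move=> F mF tF _; rewrite /lebesgue_cons /pushforward preimage_bigcup.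
have mpre A : measurable A -> measurable (@cons_rV d @^-1` A).
  by move=> mA; rewrite -[X in measurable X]setTI; exact: measurable_cons_rV.
apply: measure_semi_sigma_additive => [n|/=|]; first exact: mpre.
- apply/trivIsetP => i j _ _ ij; rewrite -preimage_setI.
  by move/trivIsetP : tF => /(_ _ _ I I ij) ->; rewrite preimage_set0.
- by apply: bigcupT_measurable => n; exact: mpre.
Qed.

HB.instance Definition _ := isMeasure.Build _ _ _ (lebesgue_cons m)
  lebesgue_cons0 lebesgue_cons_ge0 lebesgue_cons_sigma_additive.

Let uncons_rV (x : 'rV[R]_d.+1) : measurableTypeR R * 'rV[R]_d :=
  (x 0 ord0, \row_j x 0 (lift ord0 j)).

Let cons_rVK : cancel (@cons_rV d) uncons_rV.
Proof.
case=> a x; rewrite /uncons_rV /cons_rV; congr pair.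
  by rewrite mxE unlift_none.
by apply/rowP => j; rewrite !mxE liftK.
Qed.

Let measurable_uncons_rV : measurable_fun setT uncons_rV.
Proof.
apply/measurable_fun_pair; first exact: measurable_coord.
apply: measurable_fun_rV => j.
by under eq_fun do rewrite mxE; exact: measurable_coord.
Qed.

Let lebesgue_cons_sigma_finite : sigma_finite setT (lebesgue_cons m).
Proof.
have /sigma_finiteP[F [FT ndF Ffin]] := sigma_finiteT (@lebesgue_measure R).
have /sigma_finiteP[G [GT ndG Gfin]] := sigma_finiteT m.
exists (fun k => uncons_rV @^-1` (F k `*` G k)).
  rewrite -preimage_bigcup; apply/esym/seteqP; split=> // x _.
  have : (\bigcup_k F k) (uncons_rV x).1 by rewrite -FT.
  have : (\bigcup_k G k) (uncons_rV x).2 by rewrite -GT.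
  move=> [n _ Gn] [k _ Fk]; exists (maxn n k) => //; split.
  - by move: Fk; exact/subsetPset/ndF/leq_maxr.
  - by move: Gn; exact/subsetPset/ndG/leq_maxl.
move=> k; have [mF Fk] := Ffin k; have [mG Gk] := Gfin k; split.
  rewrite -[X in measurable X]setTI.
  by apply: measurable_uncons_rV => //; exact: measurableX.
rewrite /lebesgue_cons /pushforward -comp_preimage.
rewrite (_ : uncons_rV \o _ = id); last by apply/funext => p; exact: cons_rVK.
by rewrite preimage_id product_measure1E// lte_mul_pinfty// ge0_fin_numE.
Qed.

HB.instance Definition _ := @Measure_isSigmaFinite.Build _ _ _
  (lebesgue_cons m) lebesgue_cons_sigma_finite.

End lebesgue_cons.

Fixpoint lebesgue_rV d : {sigma_finite_measure set 'rV[R]_d -> \bar R} :=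
  match d with
  | 0 => dirac (0 : 'rV[R]_0)
  | d'.+1 => lebesgue_cons (lebesgue_rV d')
  end.

Lemma lebesgue_rV_box d (A : 'I_d -> set (measurableTypeR R)) :
  (forall i, measurable (A i)) ->
  lebesgue_rV d [set x : 'rV[R]_d | forall i, A i (x 0 i)] =
  (\prod_(i < d) lebesgue_measure (A i))%E.
Proof.
elim: d A => [|d IH] A mA; first by rewrite big_ord0 /= diracE mem_set// => -[].
rewrite big_ord_recl -IH// /= /lebesgue_cons /pushforward -product_measure1E//.
  congr product_measure1; apply/seteqP; split=> -[a x] /=.
    move=> h; split; first by have := h ord0; rewrite mxE unlift_none.
    by move=> i; have := h (lift ord0 i); rewrite mxE liftK.
  by move=> [h0 h] i; rewrite mxE; case: unliftP => [j|] -> /=.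
rewrite (_ : [set _ | _] = \bigcap_(i in [set: 'I_d])
    ((fun x : 'rV[R]_d => x 0 i) @^-1` A (lift ord0 i))); last first.
  by apply/seteqP; split=> x /= h i; [move=> _; exact: h|exact: (h i Logic.I)].
apply: fin_bigcap_measurable => // i _.
by rewrite -[X in measurable X]setTI; exact: measurable_coord.
Qed.

End lebesgue_rV.

Section integrable_fun.
Context {d : measure_display} {T : measurableType d} {R : realType}.
Variables (s : scalars) (mu : {measure set T -> \bar R}).

Definition scal_integrable (f : T -> (scal R s)^o) : Prop :=
  mu.-integrable setT (fun x => (scal_re (f x))%:E) /\
  mu.-integrable setT (fun x => (scal_im (f x))%:E).

Definition scal_integrable_pred : {pred T -> (scal R s)^o} :=
  [pred f | `[< scal_integrable f >]].

Lemma scal_integrable_submod_closed : submod_closed scal_integrable_pred.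
Proof.
split=> [|a f g].
- apply/asboolP; split.
  + rewrite (_ : (fun _ => _) = cst 0%E); first exact: integrable0.
    by apply/funext => x; rewrite scal_re0.
  + rewrite (_ : (fun _ => _) = cst 0%E); first exact: integrable0.
    by apply/funext => x; rewrite scal_im0.
- move=> /asboolP[fr fi] /asboolP[gr gi]; apply/asboolP; split.
  + under eq_fun do rewrite scal_reD scal_reM EFinD EFinB !EFinM.
    by apply: integrableD => //; apply: integrableB => //; exact: integrableZl.
  + under eq_fun do rewrite scal_imD scal_imM !EFinD !EFinM.
    by apply: integrableD => //; apply: integrableD => //; exact: integrableZl.
Qed.

HB.instance Definition _ := GRing.isSubmodClosed.Build _ _
  scal_integrable_pred scal_integrable_submod_closed.

Record integrable_fun := IntegrableFun {
  integrable_fun_val :> T -> (scal R s)^o;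
  _ : integrable_fun_val \in scal_integrable_pred }.

HB.instance Definition _ := [isSub for integrable_fun_val].
HB.instance Definition _ := [Choice of integrable_fun by <:].
HB.instance Definition _ := [SubChoice_isSubLmodule of integrable_fun by <:].

Lemma integrable_funP (f : integrable_fun) : scal_integrable f.
Proof. by case: f => f /= /asboolP. Qed.

Lemma measurable_modulus (f : integrable_fun) :
  measurable_fun setT (fun x => modulus (f x)).
Proof.
have [/measurable_int fr /measurable_int fi] := integrable_funP f.
apply: (@measurableT_comp _ _ _ _ _ _ (@Num.sqrt R)).
  by apply: continuous_measurable_fun; exact: sqrt_continuous.
by apply: measurable_funD; apply: measurable_funX; exact/measurable_EFinP.
Qed.

Lemma integrable_modulus (f : integrable_fun) :
  mu.-integrable setT (fun x => (modulus (f x))%:E).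
Proof.
have [fr fi] := integrable_funP f.
have /(le_integrable measurableT) := integrableD measurableT
  (integrable_abse fr) (integrable_abse fi); apply.
  exact/measurable_EFinP/measurable_modulus.
move=> x _ /=; rewrite lee_fin ger0_norm ?modulus_ge0// ger0_norm ?addr_ge0//.
exact: modulus_le.
Qed.

Definition ae_equiv (f g : integrable_fun) : bool := `[< ae_eq mu setT f g >].

Lemma ae_equiv_refl : reflexive ae_equiv.
Proof. by move=> f; apply/asboolP; exact: ae_eq_refl. Qed.

Lemma ae_equiv_sym : symmetric ae_equiv.
Proof. by move=> f g; apply/idP/idP => /asboolP/ae_eq_sym fg; exact/asboolP. Qed.

Lemma ae_equiv_trans : transitive ae_equiv.
Proof.
by move=> g f h /asboolP fg /asboolP gh; apply/asboolP; exact: ae_eq_trans gh.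
Qed.

Canonical ae_equiv_canonical :=
  EquivRel ae_equiv ae_equiv_refl ae_equiv_sym ae_equiv_trans.

Local Open Scope quotient_scope.

(* The classes are those of Borel functions; since every Lebesgue measurable
   function is a.e. equal to a Borel one, lebesgue_rV gives the usual L_1. *)
Definition L1 : Type := {eq_quot ae_equiv}.
HB.instance Definition _ := Choice.on L1.
HB.instance Definition _ := EqQuotient.on L1.

Definition L1_fun (x : L1) : T -> scal R s := repr x.

Lemma pi_L1P (f g : integrable_fun) :
  \pi_L1 f = \pi_L1 g <-> ae_eq mu setT f g.
Proof. by split=> [/eqmodP/asboolP//|fg]; apply/eqmodP/asboolP. Qed.

Lemma L1_pi (x : L1) : exists f, x = \pi_L1 f.
Proof. by exists (repr x); rewrite reprK. Qed.

Lemma repr_L1 (f : integrable_fun) : ae_eq mu setT (repr (\pi_L1 f)) f.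
Proof. by apply/pi_L1P; rewrite reprK. Qed.

Definition L1_add (x y : L1) : L1 := \pi_L1 (repr x + repr y).
Definition L1_opp (x : L1) : L1 := \pi_L1 (- repr x).
Definition L1_scale (a : scal R s) (x : L1) : L1 := \pi_L1 (a *: repr x).

Lemma pi_L1_add f g : L1_add (\pi_L1 f) (\pi_L1 g) = \pi_L1 (f + g).
Proof.
apply/pi_L1P; move: (repr_L1 f) (repr_L1 g).
apply: filterS2 => x fx gx _.
by rewrite -[LHS]/(repr (\pi_L1 f) x + repr (\pi_L1 g) x) fx// gx.
Qed.

Lemma pi_L1_opp f : L1_opp (\pi_L1 f) = \pi_L1 (- f).
Proof.
apply/pi_L1P; move: (repr_L1 f); apply: filterS => x fx _.
by rewrite -[LHS]/(- repr (\pi_L1 f) x) fx.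
Qed.

Lemma pi_L1_scale a f : L1_scale a (\pi_L1 f) = \pi_L1 (a *: f).
Proof.
apply/pi_L1P; move: (repr_L1 f); apply: filterS => x fx _.
by rewrite -[LHS]/(a *: repr (\pi_L1 f) x) fx.
Qed.

Let L1_addA : associative L1_add.
Proof.
move=> x y z; have [f ->] := L1_pi x; have [g ->] := L1_pi y; have [h ->] := L1_pi z.
by rewrite !pi_L1_add addrA.
Qed.

Let L1_addC : commutative L1_add.
Proof.
move=> x y; have [f ->] := L1_pi x; have [g ->] := L1_pi y.
by rewrite !pi_L1_add addrC.
Qed.

Let L1_add0 : left_id (\pi_L1 0) L1_add.
Proof. by move=> x; have [f ->] := L1_pi x; rewrite pi_L1_add add0r. Qed.

Let L1_addN : left_inverse (\pi_L1 0) L1_opp L1_add.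
Proof. by move=> x; have [f ->] := L1_pi x; rewrite pi_L1_opp pi_L1_add addNr. Qed.

HB.instance Definition _ :=
  GRing.isZmodule.Build L1 L1_addA L1_addC L1_add0 L1_addN.

Let L1_scaleA a b x : L1_scale a (L1_scale b x) = L1_scale (a * b) x.
Proof. by have [f ->] := L1_pi x; rewrite !pi_L1_scale scalerA. Qed.

Let L1_scale1 : left_id 1 L1_scale.
Proof. by move=> x; have [f ->] := L1_pi x; rewrite pi_L1_scale scale1r. Qed.

Let L1_scaleDr : right_distributive L1_scale +%R.
Proof.
move=> a x y; have [f ->] := L1_pi x; have [g ->] := L1_pi y.
by rewrite [_ + _]pi_L1_add !pi_L1_scale [RHS]pi_L1_add scalerDr.
Qed.

Let L1_scaleDl x : {morph L1_scale^~ x : a b / a + b}.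
Proof.
move=> a b; have [f ->] := L1_pi x.
by rewrite !pi_L1_scale [RHS]pi_L1_add scalerDl.
Qed.

HB.instance Definition _ := GRing.Zmodule_isLmodule.Build (scal R s) L1
  L1_scaleA L1_scale1 L1_scaleDr L1_scaleDl.

Definition L1_norm (x : L1) : R := fine (\int[mu]_t (modulus (L1_fun x t))%:E).

Lemma pi_L1_norm (f : integrable_fun) :
  L1_norm (\pi_L1 f) = fine (\int[mu]_t (modulus (f t))%:E).
Proof.
congr fine; apply: ae_eq_integral => //.
- exact/measurable_EFinP/measurable_modulus.
- exact/measurable_EFinP/measurable_modulus.
- by move: (repr_L1 f); apply: filterS => x fx _; rewrite /L1_fun fx.
Qed.

Let L1_normD x y :
  scal_real (L1_norm (x + y)) <=
  scal_real (L1_norm x) + scal_real (L1_norm y) :> scal R s.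
Proof.
have [f ->] := L1_pi x; have [g ->] := L1_pi y.
rewrite -scal_realD ler_scal_real [_ + _]pi_L1_add !pi_L1_norm.
have If := integrable_modulus f; have Ig := integrable_modulus g.
rewrite -fineD ?integrable_fin_num//.
rewrite -integralD// fine_le ?integrable_fin_num//.
- exact: integrable_modulus.
- exact: integrableD.
- apply: ge0_le_integral => //.
  + by move=> t _; rewrite lee_fin modulus_ge0.
  + exact/measurable_EFinP/measurable_modulus.
  + by apply: emeasurable_funD; exact/measurable_EFinP/measurable_modulus.
  + by move=> t _; rewrite -EFinD lee_fin modulusD.
Qed.

Let L1_normZ a x :
  scal_real (L1_norm (a *: x)) = `|a| * scal_real (L1_norm x) :> scal R s.
Proof.
have [f ->] := L1_pi x; rewrite norm_scal -scal_realM; congr scal_real.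
rewrite [_ *: _]pi_L1_scale !pi_L1_norm.
have If := integrable_modulus f.
rewrite -[X in X * _]/(fine (modulus a)%:E) -fineM ?integrable_fin_num//.
rewrite -integralZl//; congr fine; apply: eq_integral => t _.
by rewrite -EFinM -modulusM.
Qed.

Let L1_norm_eq0 x : scal_real (L1_norm x) = 0 :> scal R s -> x = 0.
Proof.
have [f ->] := L1_pi x; rewrite pi_L1_norm => f0; apply/pi_L1P.
have {}f0 : (\int[mu]_t (modulus (f t))%:E = 0)%E.
  rewrite -[LHS]fineK ?integrable_fin_num//; last exact: integrable_modulus.
  by congr EFin; apply: (@scal_real_inj R s); rewrite f0
    -(@modulus0 R s) -norm_scal normr0.
have /ae_eq_integral_abs : measurable_fun setT (fun t => (modulus (f t))%:E).
  exact/measurable_EFinP/measurable_modulus.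
move=> /(_ mu measurableT)[+ _].
rewrite (_ : integral _ _ _ = 0%E); last first.
  rewrite -[RHS]f0; apply: eq_integral => t _.
  by rewrite /= ger0_norm ?modulus_ge0.
move=> /(_ erefl); apply: filterS => t /(_ I) [ft0] _.
exact: modulus_eq0.
Qed.

HB.instance Definition _ := Lmodule_isNormed.Build (scal R s) L1
  L1_normD L1_normZ L1_norm_eq0.

End integrable_fun.

Section ell1.
Variables (R : realType) (s : scalars).

Definition ell1_pred : {pred nat -> (scal R s)^o} :=
  [pred a | `[< \sum_(0 <= i <oo) (modulus (a i))%:E < +oo >]%E].

Let modulus_seq_ge0 (a : nat -> scal R s) i : (0 <= (modulus (a i))%:E)%E.
Proof. by rewrite lee_fin modulus_ge0. Qed.

Let sum_modulusD (a b : nat -> (scal R s)^o) :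
  (\sum_(0 <= i <oo) (modulus ((a + b) i))%:E <=
   \sum_(0 <= i <oo) (modulus (a i))%:E +
   \sum_(0 <= i <oo) (modulus (b i))%:E)%E.
Proof.
rewrite -nneseriesD//; apply: lee_nneseries => // i _.
by rewrite -EFinD lee_fin modulusD.
Qed.

Let sum_modulusZ (c : scal R s) (a : nat -> (scal R s)^o) :
  (\sum_(0 <= i <oo) (modulus ((c *: a) i))%:E =
   (modulus c)%:E * \sum_(0 <= i <oo) (modulus (a i))%:E)%E.
Proof.
rewrite -nneseriesZl//; apply: eq_eseriesr => i _.
by rewrite -EFinM -modulusM.
Qed.

Lemma ell1_submod_closed : submod_closed ell1_pred.
Proof.
split=> [|c a b].
  apply/asboolP; rewrite eseries0// => i _ _.
  by rewrite [X in modulus X]/(0 : scal R s) modulus0.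
move=> /asboolP afin /asboolP bfin; apply/asboolP.
apply: le_lt_trans (sum_modulusD _ _) _; rewrite lte_add_pinfty//.
by rewrite sum_modulusZ lte_mul_pinfty// lee_fin modulus_ge0.
Qed.

HB.instance Definition _ := GRing.isSubmodClosed.Build _ _
  ell1_pred ell1_submod_closed.

Record ell1 := Ell1 {
  ell1_val :> nat -> (scal R s)^o;
  _ : ell1_val \in ell1_pred }.

HB.instance Definition _ := [isSub for ell1_val].
HB.instance Definition _ := [Choice of ell1 by <:].
HB.instance Definition _ := [SubChoice_isSubLmodule of ell1 by <:].

Definition ell1_norm (a : ell1) : R :=
  fine (\sum_(0 <= i <oo) (modulus (a i))%:E).

Lemma ell1_fin_num (a : ell1) :
  (\sum_(0 <= i <oo) (modulus (a i))%:E)%E \is a fin_num.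
Proof.
rewrite ge0_fin_numE; first by case: a => a /= /asboolP.
exact: nneseries_ge0.
Qed.

Let ell1_normD (a b : ell1) :
  scal_real (ell1_norm (a + b)) <=
  scal_real (ell1_norm a) + scal_real (ell1_norm b) :> scal R s.
Proof.
rewrite -scal_realD ler_scal_real -lee_fin EFinD !fineK ?ell1_fin_num//.
exact: sum_modulusD.
Qed.

Let ell1_normZ (c : scal R s) (a : ell1) :
  scal_real (ell1_norm (c *: a)) = `|c| * scal_real (ell1_norm a) :> scal R s.
Proof.
rewrite norm_scal -scal_realM; congr scal_real; apply: EFin_inj.
by rewrite EFinM !fineK ?ell1_fin_num// -sum_modulusZ.
Qed.

Let ell1_norm_eq0 (a : ell1) : scal_real (ell1_norm a) = 0 :> scal R s -> a = 0.
Proof.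
rewrite -[in RHS](normr0 (scal R s)) norm_scal modulus0 => /scal_real_inj a0.
apply/val_inj/funext => i; apply/modulus_eq0/le_anti.
rewrite modulus_ge0 andbT -lee_fin.
have {}a0 : (\sum_(0 <= i <oo) (modulus (a i))%:E = 0)%E.
  by rewrite -[LHS]fineK ?ell1_fin_num//; congr EFin.
rewrite -[leRHS]a0 (nneseriesD1 (n := i))// leeDl//.
exact: nneseries_ge0.
Qed.

HB.instance Definition _ := Lmodule_isNormed.Build (scal R s) ell1
  ell1_normD ell1_normZ ell1_norm_eq0.

End ell1.

Section subsp.
Context {K : numFieldType} {V : normedModType K}.
Variable X : submodClosed V.

Record subsp := Subsp { subsp_val :> V; _ : subsp_val \in X }.

HB.instance Definition _ := [isSub for subsp_val].
HB.instance Definition _ := [Choice of subsp by <:].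
HB.instance Definition _ := [SubChoice_isSubLmodule of subsp by <:].

Let subsp_normD (x y : subsp) : `|val (x + y)| <= `|val x| + `|val y|.
Proof. exact: ler_normD. Qed.

Let subsp_normZ (a : K) (x : subsp) : `|val (a *: x)| = `|a| * `|val x|.
Proof. exact: normrZ. Qed.

Let subsp_norm_eq0 (x : subsp) : `|val x| = 0 -> x = 0.
Proof. by move=> /normr0_eq0 x0; apply: val_inj. Qed.

HB.instance Definition _ := Lmodule_isNormed.Build K subsp
  subsp_normD subsp_normZ subsp_norm_eq0.

End subsp.

Arguments subsp_val {K V X}.

Section normed_spaces.
Context {K : numFieldType}.
Implicit Types U V : normedModType K.

Definition infinite_dimensional V : Prop :=
  forall (n : nat) (v : 'I_n -> V),
    exists x, forall c : 'I_n -> K, x <> \sum_(i < n) c i *: v i.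

Definition bounded_op U V (f : U -> V) : Prop :=
  exists M : K, forall x, `|f x| <= M * `|x|.

Definition isomorphism U V (f : {linear U -> V}) : Prop :=
  bounded_op f /\
  exists f_inv : V -> U, [/\ cancel f f_inv, cancel f_inv f & bounded_op f_inv].

(* The range of a bounded projection is automatically closed. *)
Definition complemented V (Y : submodClosed V) : Prop :=
  exists P : {linear V -> V},
    [/\ bounded_op P, forall x, P x \in Y & forall x, x \in Y -> P x = x].

Definition unconditionally_convergent V (x : nat -> V) : Prop :=
  forall p : nat -> nat, bijective p -> cvgn (series (x \o p)).

Definition approximate_schauder_frame V
    (f : nat -> V) (f' : nat -> {linear V -> K^o}) : Prop :=
  (forall i, bounded_op (f' i)) /\
  exists S : {linear V -> V}, isomorphism S /\
    forall g, series (fun i => f' i g *: f i) @ \oo --> S g.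

Definition unconditional_approximate_schauder_frame V
    (f : nat -> V) (f' : nat -> {linear V -> K^o}) : Prop :=
  approximate_schauder_frame f f' /\
  forall g, unconditionally_convergent (fun i => f' i g *: f i).

End normed_spaces.

Section translates.
Context {R : realType} {s : scalars} {d : nat}.
Local Notation L1d := (L1 s (lebesgue_rV d : {measure set 'rV[R]_d -> \bar R})).

Definition translate (lambda : 'rV[R]_d) (f : 'rV[R]_d -> scal R s) :=
  fun x => f (x - lambda).

(* Equality in L_1, stated on representatives; it does not depend on the
   representatives since Lebesgue measure is translation invariant. *)
Definition sequence_of_translates (f : nat -> L1d) k0 (g : 'I_k0 -> L1d)
    (lambda : nat -> 'rV[R]_d) : Prop :=
  forall i, exists k, ae_eq (lebesgue_rV d) setT
    (L1_fun (f i)) (translate (lambda i) (L1_fun (g k))).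

Definition translates_of_finite_family (f : nat -> L1d)
    (lambda : nat -> 'rV[R]_d) : Prop :=
  exists k0 (g : 'I_k0 -> L1d),
    [/\ injective g, forall k, g k != 0 & sequence_of_translates f g lambda].

(* The norm of the normedModType 'rV[R]_d is the sup norm. *)
Definition euclidean_norm (x : 'rV[R]_d) : R :=
  Num.sqrt (\sum_(i < d) x 0 i ^+ 2).

Definition uniformly_separated (Delta : set nat) (lambda : nat -> 'rV[R]_d) :
    Prop :=
  exists2 delta : R, 0 < delta &
    forall i j, Delta i -> Delta j -> i != j ->
      delta <= euclidean_norm (lambda i - lambda j).

Definition relatively_uniformly_separated (lambda : nat -> 'rV[R]_d) : Prop :=
  exists m (Delta : 'I_m -> set nat),
    [/\ \bigcup_k Delta k = setT, trivIset setT Delta &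
        forall k, uniformly_separated (Delta k) lambda].

End translates.

(* Main.v *)
Require Import Defs.
From HB Require Import structures.
From mathcomp Require Import all_boot all_order all_algebra complex.
From mathcomp Require Import all_classical all_reals all_analysis measurable_realfun.
From mathcomp Require Import ring lra.
Import numFieldNormedType.Exports.
Set Implicit Arguments.
Unset Strict Implicit.
Unset Printing Implicit Defensive.
Import Order.TTheory GRing.Theory Num.Theory.
Local Open Scope classical_set_scope.
Local Open Scope ring_scope.

(** Write A for the coefficient map g |-> (f'_i(g))_i and Phi for the synthesis
    map a |-> sum_i a_i f_i, so that Phi A is the invertible operator S of the
    frame. Everything rests on A taking its values in ell_1.

    Fix g and put a_i = f'_i(g). Unconditional convergence makes all subset
    sums over a late finite set of indices small
    ([unconditional_small_tails]). Split the indices into finitely many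
    classes, on each of which f_i is a translate of one fixed g_k and the
    lambda_i are delta-separated, and choose Q of diameter less than delta with
    c = int_Q |g_k| > 0 ([positive_cell]). The sets lambda_i + Q are disjoint.
    On lambda_i + Q the average of |sum_(j in G) a_j f_j| over all subsets G of a
    finite set of indices containing i is at least |a_i f_i| / 2, because adding
    or removing i changes the sum by a_i f_i ([sum_subsets_ge]). Integrating and using
    translation invariance gives c * sum_i |a_i| <= 2 max_G |sum_(i in G) a_i f_i|
    ([separated_translates_lower]), whence sum_i |a_i| is finite
    ([unconditional_coefficients]).

    By uniform boundedness A is then a bounded operator into ell_1
    ([analysis_op]). The norms |f_i| take finitely many values and X is
    complete, so Phi is bounded as well ([ell1_column_op]); hence
    B = S^-1 Phi is a bounded left inverse of A, and A is an isomorphism onto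
    the range of the projection A B ([frame_retraction]).

    It remains to see that an infinite-dimensional complemented subspace of
    ell_1 is isomorphic to ell_1. A gliding hump argument gives a copy of ell_1
    complemented in X ([ell1_complemented_copy]), and Pelczynski's decomposition
    method concludes ([ell1_decomposition]). In it direct sums are never
    formed: ell_1 is cut into countably many blocks isometric to itself and the
    isomorphism is written down block by block. *)

(** * Real-valued norms and bounded operators *)

Section real_norm.
Context {R : realType} {s : scalars}.
Local Notation K := (scal R s).
Implicit Types U V W : normedModType K.

Lemma scal_realK (a : R) : scal_re (scal_real a : K) = a.
Proof. by rewrite /scal_re /scal_real; case: s. Qed.

Lemma scal_real0 : scal_real 0 = 0 :> K.
Proof. by rewrite /scal_real; case: s. Qed.

Lemma scal_real1 : scal_real 1 = 1 :> K.
Proof. by rewrite /scal_real; case: s. Qed.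

Lemma ge0_scal_real (z : K) : 0 <= z -> z = scal_real (scal_re z).
Proof. by move=> z0; rewrite -(ger0_norm z0) norm_scal scal_realK. Qed.

Lemma modulus_real (a : R) : modulus (scal_real a : K) = `|a|.
Proof.
rewrite /modulus /scal_re /scal_im /scal_real; case: s => /=;
  by rewrite expr0n addr0 sqrtr_sqr.
Qed.

Lemma modulus1 : modulus (1 : K) = 1.
Proof. by rewrite -scal_real1 modulus_real normr1. Qed.

Lemma modulusN (z : K) : modulus (- z) = modulus z.
Proof. by apply: (@scal_real_inj R s); rewrite -!norm_scal normrN. Qed.

(** The norm of a normed module over R[i] is a complex number; order and limit
    arguments are carried out on its real part. *)
Definition rnorm V (x : V) : R := scal_re `|x|.

Lemma norm_rnorm V (x : V) : `|x| = scal_real (rnorm x).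
Proof. exact/ge0_scal_real/normr_ge0. Qed.

Lemma rnorm_modulus (z : K^o) : rnorm z = modulus z.
Proof. by rewrite /rnorm -[`|z|]/(`|z : K|) norm_scal scal_realK. Qed.

Lemma rnorm_ge0 V (x : V) : 0 <= rnorm x.
Proof. by rewrite -(ler_scal_real (s := s)) scal_real0 -norm_rnorm. Qed.

Lemma rnorm0 V : rnorm (0 : V) = 0.
Proof. by rewrite /rnorm normr0 scal_re0. Qed.

Lemma rnormN V (x : V) : rnorm (- x) = rnorm x.
Proof. by rewrite /rnorm normrN. Qed.

Lemma rdistC V (x y : V) : rnorm (x - y) = rnorm (y - x).
Proof. by rewrite -rnormN opprB. Qed.

Lemma rnorm_eq0 V (x : V) : rnorm x = 0 -> x = 0.
Proof. by move=> x0; apply/normr0_eq0; rewrite norm_rnorm x0 scal_real0. Qed.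

Lemma rnormD V (x y : V) : rnorm (x + y) <= rnorm x + rnorm y.
Proof.
by rewrite -(ler_scal_real (s := s)) scal_realD -!norm_rnorm ler_normD.
Qed.

Lemma rnormB V (x y : V) : rnorm (x - y) <= rnorm x + rnorm y.
Proof. by rewrite -(rnormN y) rnormD. Qed.

Lemma rnormZ V (a : K) (x : V) : rnorm (a *: x) = modulus a * rnorm x.
Proof.
by apply: (@scal_real_inj R s); rewrite scal_realM -!norm_rnorm normrZ norm_scal.
Qed.

Lemma rnorm_sum V I (r : seq I) (P : pred I) (x : I -> V) :
  rnorm (\sum_(i <- r | P i) x i) <= \sum_(i <- r | P i) rnorm (x i).
Proof.
elim/big_ind2: _ => [|a u b v au bv|//]; first by rewrite rnorm0.
exact: le_trans (rnormD _ _) (lerD au bv).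
Qed.

Lemma rnorm_subsp V (X : submodClosed V) (x : subsp X) :
  rnorm x = rnorm (subsp_val x).
Proof. by []. Qed.

Lemma cvg_rnormP V (u : nat -> V) (l : V) : u @ \oo --> l <->
  forall e : R, 0 < e -> exists N, forall n, (N <= n)%N -> rnorm (l - u n) < e.
Proof.
have ltE (a b : R) : (scal_real a < scal_real b :> K) = (a < b).
  rewrite !lt_neqAle ler_scal_real; congr (~~ _ && _).
  by apply/eqP/eqP => [/scal_real_inj|->].
split=> [/cvgrPdist_lt ul e e0|h].
  have := ul (scal_real e); rewrite -scal_real0 ltE => /(_ e0) [N _ hN].
  by exists N => n Nn; have := hN n Nn; rewrite /= norm_rnorm ltE.
apply/cvgrPdist_lt => e e0; have eE := ge0_scal_real (ltW e0).
have : 0 < scal_re e by rewrite -ltE -eE scal_real0.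
move=> /h[N hN]; exists N => // n /= Nn.
by rewrite eE norm_rnorm ltE hN.
Qed.

Lemma rnorm_cvg_le V (u : nat -> V) (l : V) (M : R) : u @ \oo --> l ->
  (forall n, rnorm (u n) <= M) -> rnorm l <= M.
Proof.
move=> /cvg_rnormP ul uM; apply/ler_addgt0Pr => e /ul [N /(_ N (leqnn _)) hN].
rewrite -(subrK (u N) l); apply: le_trans (rnormD _ _) _.
by rewrite addrC lerD // ltW.
Qed.

Lemma bounded_opP U V (f : U -> V) : bounded_op f <->
  exists2 M : R, 0 <= M & forall x, rnorm (f x) <= M * rnorm x.
Proof.
split=> [[M fM]|[M M0 fM]].
  exists (modulus M) => [|x]; first exact: modulus_ge0.
  have Mx : 0 <= M * `|x| := le_trans (normr_ge0 _) (fM x).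
  rewrite -(ler_scal_real (s := s)) scal_realM -!norm_rnorm -norm_scal.
  by have := fM x; rewrite -{1}(ger0_norm Mx) normrM normr_id.
exists (scal_real M) => x.
by rewrite !norm_rnorm -scal_realM ler_scal_real.
Qed.

Definition pack_linear U V (f : U -> V) (lf : linear f) : {linear U -> V} :=
  HB.pack f (GRing.isLinear.Build K U V *:%R f lf).

Lemma bounded_op_comp U V W (f : U -> V) (g : V -> W) :
  bounded_op f -> bounded_op g -> bounded_op (g \o f).
Proof.
move=> /bounded_opP[M M0 fM] /bounded_opP[N N0 gN]; apply/bounded_opP.
exists (N * M) => [|x]; first exact: mulr_ge0.
by rewrite -mulrA; apply: le_trans (gN _) _; rewrite ler_wpM2l.
Qed.

Lemma bounded_opD U V (f g : U -> V) :
  bounded_op f -> bounded_op g -> bounded_op (fun x => f x + g x).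
Proof.
move=> /bounded_opP[M M0 fM] /bounded_opP[N N0 gN]; apply/bounded_opP.
exists (M + N) => [|x]; first exact: addr_ge0.
by rewrite mulrDl; apply: le_trans (rnormD _ _) _; rewrite lerD.
Qed.

Lemma bounded_opB U V (f g : U -> V) :
  bounded_op f -> bounded_op g -> bounded_op (fun x => f x - g x).
Proof.
move=> fb /bounded_opP[N N0 gN]; apply: bounded_opD => //.
by apply/bounded_opP; exists N => // x; rewrite rnormN.
Qed.

Lemma bounded_op_id U : bounded_op (fun x : U => x).
Proof. by apply/bounded_opP; exists 1 => // x; rewrite mul1r. Qed.

(** Equivalent to completeness of V, in the form in which it is used: every
    limit taken below is the sum of an absolutely convergent series. *)
Definition summable_complete V : Prop :=
  forall x : nat -> V, (exists M : R, forall n, \sum_(i < n) rnorm (x i) <= M) ->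
    cvgn (series x).

End real_norm.

(** * Density of finitely supported sequences in ell_1 *)

Section ell1_basics.
Context {R : realType} {s : scalars}.
Local Notation K := (scal R s).
Local Notation ell1 := (ell1 R s).
Implicit Types (a b : ell1) (V : normedModType K).

Lemma ell1_mem (a : nat -> K) (M : R) :
  (forall n, \sum_(i < n) modulus (a i) <= M) -> (a : nat -> K^o) \in @ell1_pred R s.
Proof.
move=> aM; apply/asboolP; apply: (@le_lt_trans _ _ M%:E); last exact: ltry.
apply: lime_le; first by apply: is_cvg_nneseries => i _ _; rewrite lee_fin modulus_ge0.
by apply: nearW => n; rewrite sumEFin lee_fin big_mkord.
Qed.

Lemma rnorm_ell1 a : rnorm a = ell1_norm a.
Proof. exact: scal_realK. Qed.

Lemma ell1_norm_le a (M : R) :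
  (forall n, \sum_(i < n) modulus (a i) <= M) -> rnorm a <= M.
Proof.
move=> aM; rewrite rnorm_ell1 -lee_fin /ell1_norm fineK ?ell1_fin_num//.
apply: lime_le; first by apply: is_cvg_nneseries => i _ _; rewrite lee_fin modulus_ge0.
by apply: nearW => n; rewrite sumEFin lee_fin big_mkord.
Qed.

Lemma ell1_partial_le a n : \sum_(i < n) modulus (a i) <= rnorm a.
Proof.
rewrite rnorm_ell1 -lee_fin /ell1_norm fineK ?ell1_fin_num//.
rewrite -(big_mkord xpredT (fun i => modulus (a i))) -sumEFin.
by apply: nneseries_lim_ge => i _ _; rewrite lee_fin modulus_ge0.
Qed.

Lemma ell1_partial_gt a (M : R) : M < rnorm a ->
  exists n, M < \sum_(i < n) modulus (a i).
Proof.
move=> Ma; apply: contrapT => h.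
have : rnorm a <= M; last by rewrite leNgt Ma.
apply: ell1_norm_le => n; rewrite leNgt; apply/negP => hn.
by apply: h; exists n.
Qed.

Lemma ell1_addE a b n : (a + b) n = a n + b n. Proof. by []. Qed.
Lemma ell1_subE a b n : (a - b) n = a n - b n. Proof. by []. Qed.
Lemma ell1_scaleE (c : K) a n : (c *: a) n = c * a n. Proof. by []. Qed.

Lemma ell1_eq a b : (forall n, a n = b n) -> a = b.
Proof. by move=> ab; apply/val_inj/funext. Qed.

Lemma sum_kronecker (V : nmodType) (n k : nat) (c : V) :
  \sum_(i < n) (if val i == k then c else 0) = if (k < n)%N then c else 0.
Proof.
case: ltnP => kn; last first.
  by apply: big1 => i _; rewrite ltn_eqF// (leq_trans (ltn_ord i)).
rewrite (bigD1 (Ordinal kn)) //= eqxx big1 ?addr0// => i.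
by rewrite -val_eqE /= => /negbTE ->.
Qed.

Fact unit_seq_mem k : (fun i => (i == k)%:R : K^o) \in @ell1_pred R s.
Proof.
apply: (@ell1_mem _ 1) => n.
rewrite (eq_bigr (fun i : 'I_n => if val i == k then 1 else 0)).
  by rewrite sum_kronecker; case: ifP.
by move=> i _; case: eqP => _; rewrite ?modulus1 ?modulus0.
Qed.

Definition ell1_unit k : ell1 := Ell1 (unit_seq_mem k).

Lemma ell1_head_sumE a n i :
  (\sum_(k < n) a k *: ell1_unit k) i = if (i < n)%N then a i else 0.
Proof.
elim: n => [|n IH]; first by rewrite big_ord0.
rewrite big_ord_recr ell1_addE IH ell1_scaleE /= ltnS.
case: ltngtP => ni; rewrite ?mulr0 ?addr0 ?add0r//.
by rewrite ni mulr1.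
Qed.

(** The error is the tail of the series of moduli of a. *)
Lemma ell1_head_cvg a :
  (fun n => \sum_(k < n) a k *: ell1_unit k) @ \oo --> a.
Proof.
apply/cvg_rnormP => e e0.
have [|N hN] := @ell1_partial_gt a (rnorm a - e / 2).
  by rewrite ltrBlDr ltrDl divr_gt0.
exists N => n Nn; apply: (@le_lt_trans _ _ (e / 2)); last by rewrite ltr_pdivrMr// ltr_pMr// ltr1n.
pose t : ell1 := a - \sum_(k < n) a k *: ell1_unit k.
have tE i : t i = if (i < n)%N then 0 else a i.
  by rewrite /t ell1_subE ell1_head_sumE; case: ifP; rewrite ?subrr ?subr0.
rewrite -/t; clearbody t; apply: ell1_norm_le => m.
apply: (@le_trans _ _ (\sum_(n <= i < maxn m n) modulus (a i))).
  rewrite -(big_mkord xpredT (fun i => modulus (t i))).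
  apply: (@le_trans _ _ (\sum_(0 <= i < maxn m n) modulus (t i))).
    rewrite [leRHS](@big_cat_nat _ _ _ m 0 (maxn m n))//= ?leq_maxl// lerDl.
    by apply: sumr_ge0 => i _; exact: modulus_ge0.
  rewrite (@big_cat_nat _ _ _ n 0 (maxn m n))//= ?leq_maxr//.
  rewrite big_nat big1 ?add0r.
    rewrite big_nat [leRHS]big_nat; apply: ler_sum => i /andP[ni _].
    by rewrite tE ltnNge ni.
  by move=> i /andP[_ ni]; rewrite tE ni modulus0.
have := ell1_partial_le a (maxn m n); rewrite -(big_mkord xpredT (fun i => modulus (a i))).
rewrite (@big_cat_nat _ _ _ N 0 (maxn m n))//=; last by rewrite (leq_trans Nn)// leq_maxr.
rewrite (@big_cat_nat _ _ _ n N (maxn m n))//= ?leq_maxr//.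
move: hN; rewrite -(big_mkord xpredT (fun i => modulus (a i))).
have : 0 <= \sum_(N <= i < n) modulus (a i).
  by apply: sumr_ge0 => i _; exact: modulus_ge0.
set x := (\sum_(0 <= i < N) _); set y := (\sum_(N <= i < n) _).
set z := (\sum_(n <= i < _) _).
lra.
Qed.

(** Bounded operators agree on the closure of any set where they agree, and the
    unit vectors span a dense subspace. *)
Lemma bounded_op_ell1_eq V (f g : {linear ell1 -> V}) :
  bounded_op f -> bounded_op g ->
  (forall k, f (ell1_unit k) = g (ell1_unit k)) -> f =1 g.
Proof.
move=> fb gb fg a.
have /bounded_opP[M M0 hM] := bounded_opB fb gb.
apply/eqP; rewrite -subr_eq0; apply/eqP/rnorm_eq0/le_anti.
rewrite rnorm_ge0 andbT; apply/ler_addgt0Pr => e e0; rewrite add0r.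
have e1 : 0 < e / (M + 1) by rewrite divr_gt0// ltr_wpDl.
have /cvg_rnormP /(_ _ e1) [N /(_ N (leqnn _)) hN] := @ell1_head_cvg a.
set h := \sum_(k < N) _ in hN.
have -> : f a - g a = f (a - h) - g (a - h).
  have : f h = g h.
    rewrite /h !linear_sum; apply: eq_bigr => k _.
    by rewrite !linearZ /= fg.
  by rewrite (linearB f) (linearB g) => ->; rewrite opprB addrA subrK.
apply: le_trans (hM _) _.
apply: le_trans (ler_wpM2l M0 (ltW hN)) _.
rewrite mulrCA ler_piMr ?(ltW e0)// ler_pdivrMr ?mul1r ?lerDl//.
by rewrite ltr_wpDl.
Qed.

End ell1_basics.

(** * Splitting ell_1 into infinitely many copies of itself *)

Lemma ler_sum_uniq_sub {R : realType} {I : eqType} (r1 r2 : seq I) (u : I -> R) :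
  (forall i, 0 <= u i) -> uniq r1 -> uniq r2 -> {subset r1 <= r2} ->
  \sum_(i <- r1) u i <= \sum_(i <- r2) u i.
Proof.
move=> u0 ur1 ur2 r12.
rewrite (perm_big [seq i <- r2 | i \in r1]) /=; last first.
  apply: uniq_perm => //; first exact: filter_uniq.
  by move=> i; rewrite mem_filter /=; case: (boolP (i \in r1)) => // /r12 ->.
by rewrite big_filter big_mkcond ler_sum// => i _; case: ifP.
Qed.

Section blocks.
Context {R : realType} {s : scalars}.
Local Notation K := (scal R s).
Local Notation ell1 := (ell1 R s).

Lemma ell1_norm_cvg (a : ell1) :
  (fun n => \sum_(i < n) modulus (a i)) @ \oo --> rnorm a.
Proof.
apply/(@cvgrPdist_le _ R^o) => e e0.
have [|N hN] := @ell1_partial_gt _ _ a (rnorm a - e); first by rewrite ltrBlDr ltrDl.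
exists N => // n /= Nn.
rewrite ger0_norm ?subr_ge0 ?ell1_partial_le// lerBlDr addrC -lerBlDr.
apply: le_trans (ltW hN) _.
rewrite -!(big_mkord xpredT (fun i => modulus (a i))) [leRHS](big_cat_nat (n := N))//=.
by rewrite lerDl sumr_ge0// => i _; exact: modulus_ge0.
Qed.

Variables (p : nat * nat -> nat) (q : nat -> nat * nat).
Hypotheses (pK : cancel p q) (qK : cancel q p).

(** The rectangle [0, n[ x [0, m[ is sent injectively by p into an initial
    segment of nat. *)
Lemma sum_block_head_le (a : ell1) n m :
  \sum_(i < n) \sum_(k < m) modulus (a (p (val i, val k))) <= rnorm a.
Proof.
pose r := [seq p (i, k) | i <- iota 0 n, k <- iota 0 m].
pose N := (\max_(j <- r) j).+1.
apply: le_trans (ell1_partial_le a N).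
rewrite -(big_mkord xpredT (fun i => \sum_(k < m) modulus (a (p (i, val k))))).
rewrite -(big_mkord xpredT (fun i => modulus (a i))).
under eq_bigr do rewrite -(big_mkord xpredT (fun k => modulus (a (p (_, k))))).
rewrite /index_iota !subn0 -(big_allpairs_dep (h := fun i k => p (i, k)) (F := fun j => modulus (a j))).
apply: ler_sum_uniq_sub.
- by move=> i; exact: modulus_ge0.
- rewrite allpairs_uniq ?iota_uniq// => -[i k] [i' k'] _ _ /=.
  exact: can_inj pK _ _.
- exact: iota_uniq.
- by move=> j jr; rewrite mem_iota add0n ltnS; exact: leq_bigmax_seq.
Qed.

Fact block_mem n (a : ell1) : (fun k => a (p (n, k)) : K^o) \in @ell1_pred R s.
Proof.
apply: (@ell1_mem _ _ _ (rnorm a)) => m.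
apply: le_trans (sum_block_head_le a n.+1 m).
rewrite [leRHS]big_ord_recr /= lerDr; apply: sumr_ge0 => i _.
by apply: sumr_ge0 => k _; exact: modulus_ge0.
Qed.

Definition block_fun n (a : ell1) : ell1 := Ell1 (block_mem n a).

Fact block_linear n : linear (block_fun n).
Proof. by move=> c a b; exact: ell1_eq. Qed.

Definition block n : {linear ell1 -> ell1} := pack_linear (block_linear n).

Lemma sum_rnorm_block_le (a : ell1) n : \sum_(i < n) rnorm (block i a) <= rnorm a.
Proof.
have h : (fun m => \sum_(i < n) \sum_(k < m) modulus (block i a k)) @ \oo -->
    (\sum_(i < n) rnorm (block i a) : R^o).
  by apply: cvg_big => [|i _]; [exact: add_continuous|exact: ell1_norm_cvg].
rewrite -(cvg_lim _ h)//; apply: limr_le; first by apply/cvg_ex; eexists; exact: h.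
by apply: nearW => m; exact: sum_block_head_le.
Qed.

Lemma rnorm_block_le (a : ell1) n : rnorm (block n a) <= rnorm a.
Proof.
apply: le_trans (sum_rnorm_block_le a n.+1); rewrite big_ord_recr /= lerDr.
by apply: sumr_ge0 => i _; exact: rnorm_ge0.
Qed.

Lemma bounded_op_block n : bounded_op (block n).
Proof. by apply/bounded_opP; exists 1 => // a; rewrite mul1r rnorm_block_le. Qed.

Lemma block_ext (a b : ell1) : (forall n, block n a = block n b) -> a = b.
Proof.
move=> ab; apply: ell1_eq => j; rewrite -(qK j); case: (q j) => n k.
by have := congr1 (fun c : ell1 => c k) (ab n).
Qed.

Section glue.
Variables (b : nat -> ell1) (M : R).
Hypothesis bM : forall n, \sum_(i < n) rnorm (b i) <= M.

(** Converse of [sum_block_head_le]: q sends an initial segment of nat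
    injectively into a square. *)
Lemma sum_glue_le N : \sum_(j < N) modulus (b (q j).1 (q j).2) <= M.
Proof.
pose n := (\max_(j < N) maxn (q j).1 (q j).2).+1.
apply: le_trans (bM n).
apply: (@le_trans _ _ (\sum_(i < n) \sum_(k < n) modulus (b i k))); last first.
  by apply: ler_sum => i _; exact: ell1_partial_le.
rewrite -(big_mkord xpredT (fun j => modulus (b (q j).1 (q j).2))).
rewrite -(big_mkord xpredT (fun i => \sum_(k < n) modulus (b i k))).
under [leRHS]eq_bigr do rewrite -(big_mkord xpredT (fun k => modulus (b _ k))).
rewrite /index_iota !subn0.
rewrite -(big_allpairs_dep (h := @pair nat nat) (F := fun j => modulus (b j.1 j.2))).
rewrite -(big_map q xpredT (fun j => modulus (b j.1 j.2))).
apply: ler_sum_uniq_sub.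
- by move=> i; exact: modulus_ge0.
- by rewrite (map_inj_uniq (can_inj qK)) iota_uniq.
- by rewrite allpairs_uniq ?iota_uniq// => -[i k] [i' k'] _ _ /=.
move=> _ /mapP[j + ->]; rewrite mem_iota add0n => /andP[_ jN].
have := leq_bigmax (F := fun j : 'I_N => maxn (q j).1 (q j).2) (Ordinal jN).
rewrite geq_max => /andP[h1 h2].
by apply/allpairsPdep; exists (q j).1, (q j).2; rewrite !mem_iota !add0n !ltnS h1 h2; case: (q j).
Qed.

Fact glue_mem : (fun j => b (q j).1 (q j).2 : K^o) \in @ell1_pred R s.
Proof. exact: ell1_mem sum_glue_le. Qed.

Definition glue : ell1 := Ell1 glue_mem.

Lemma rnorm_glue_le : rnorm glue <= M.
Proof. by apply: ell1_norm_le => n; exact: sum_glue_le. Qed.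

End glue.

(** The blocks identify ell_1 with the ell_1-sum of countably many copies of
    itself; this is how operators into that sum are produced. *)
Lemma glue_op (U : normedModType K) (T : nat -> {linear U -> ell1}) (M : R) :
  0 <= M -> (forall x n, \sum_(i < n) rnorm (T i x) <= M * rnorm x) ->
  exists2 G : {linear U -> ell1}, bounded_op G & forall x n, block n (G x) = T n x.
Proof.
move=> M0 TM.
pose G x : ell1 := glue (b := fun i => T i x) (TM x).
have lG : linear G by move=> c x y; apply: ell1_eq => j; rewrite /= linearP.
exists (pack_linear lG); last by move=> x n; apply: ell1_eq => k; rewrite /= pK.
by apply/bounded_opP; exists M => // x; exact: rnorm_glue_le.
Qed.

End blocks.

Lemma nat2_bijection : exists (p : nat * nat -> nat) (q : nat -> nat * nat),
  cancel p q /\ cancel q p.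
Proof.
have /card_set_bijP[p] := card_nat2.
by rewrite setTT_bijective => -[q pK qK]; exists p, q.
Qed.

(** * Pelczynski decomposition *)

Section decomposition.
Context {R : realType} {s : scalars}.
Local Notation K := (scal R s).
Local Notation ell1 := (ell1 R s).

Section glue_neighbours.
Variables (p : nat * nat -> nat) (q : nat -> nat * nat).
Hypotheses (pK : cancel p q) (qK : cancel q p).

Lemma sum_rnorm_block_shift_le (a : ell1) n k :
  \sum_(i < n) rnorm (block pK (k + i) a) <= rnorm a.
Proof.
apply: le_trans (sum_rnorm_block_le pK a (k + n)).
rewrite [leRHS]big_split_ord /= lerDr.
by apply: sumr_ge0 => i _; exact: rnorm_ge0.
Qed.

(** The form of [glue_op] for a T whose n-th component depends boundedly on a
    few consecutive blocks of E x: the blocks of E x have summable norms, so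
    only the component T 0 needs a bound of its own. *)
Lemma glue_neighbours (U : normedModType K) (T : nat -> {linear U -> ell1})
    (E : {linear U -> ell1}) (M : R) :
  bounded_op (T 0%N) -> bounded_op E -> 0 <= M ->
  (forall n x, rnorm (T n.+1 x) <= M * (rnorm (block pK n (E x)) +
    rnorm (block pK n.+1 (E x)) + rnorm (block pK n.+2 (E x)))) ->
  exists2 G : {linear U -> ell1}, bounded_op G & forall x n, block pK n (G x) = T n x.
Proof.
move=> /bounded_opP[M0 M00 hT0] /bounded_opP[N N0 hE] M_ge0 hT.
apply: (glue_op pK qK (M := M0 + M * (N *+ 3))).
  by rewrite addr_ge0// mulr_ge0// mulrn_wge0.
move=> x [|n]; first by rewrite big_ord0 mulr_ge0 ?rnorm_ge0// addr_ge0// mulr_ge0// mulrn_wge0.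
rewrite big_ord_recl mulrDl lerD ?hT0//.
apply: le_trans (ler_sum _ (fun i _ => hT (val i) x)) _.
rewrite -mulr_sumr -mulrA ler_wpM2l// !big_split /= !mulrSr mulr0n add0r !mulrDl.
have hk k : \sum_(i < n) rnorm (block pK (k + i) (E x)) <= N * rnorm x.
  exact: le_trans (sum_rnorm_block_shift_le _ _ _) (hE x).
exact: lerD (lerD (hk 0%N) (hk 1%N)) (hk 2%N).
Qed.

End glue_neighbours.

(** With P = A B and Q = C D, X is isomorphic to P(ell_1), and ell_1 to Q(X).
    The classical proof uses ell_1 = X + (1 - P) ell_1 and
    X = ell_1 + (1 - Q) X and moves the summands of ell_1(ell_1) by one place.
    Composing these isomorphisms gives the map below: if z = D y has blocks
    z_0, z_1, z_2, ..., put x = (1 - Q) y + C z_0; the image of y has block 0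
    equal to A x + (1 - P) z_1 and block n + 1 equal to
    P z_(n+1) + (1 - P) z_(n+2). *)
Theorem ell1_decomposition (X : normedModType K)
    (A : {linear X -> ell1}) (B : {linear ell1 -> X})
    (C : {linear ell1 -> X}) (D : {linear X -> ell1}) :
  bounded_op A -> bounded_op B -> bounded_op C -> bounded_op D ->
  cancel A B -> cancel C D -> exists T : {linear X -> ell1}, isomorphism T.
Proof.
move=> Ab Bb Cb Db AK CK.
have [p [q [pK qK]]] := nat2_bijection.
pose blk n := block (s := s) pK n (R := R).
have blkb n : bounded_op (blk n) by exact: bounded_op_block.
pose P : {linear ell1 -> ell1} := A \o B.
pose P' : {linear ell1 -> ell1} := idfun \- (A \o B).
have Pb : bounded_op P by exact: bounded_op_comp.
have P'b : bounded_op P' by apply: bounded_opB => //; exact: bounded_op_id.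
have [M M0 [PM P'M]] : exists2 M : R, 0 <= M &
    (forall a, rnorm (P a) <= M * rnorm a) /\ (forall a, rnorm (P' a) <= M * rnorm a).
  have /bounded_opP[M1 M10 h1] := Pb; have /bounded_opP[M2 M20 h2] := P'b.
  exists (M1 + M2); first exact: addr_ge0.
  split=> a; rewrite mulrDl.
    by rewrite (le_trans (h1 a))// lerDl mulr_ge0// rnorm_ge0.
  by rewrite (le_trans (h2 a))// lerDr mulr_ge0// rnorm_ge0.
pose T0 : {linear X -> ell1} :=
  (A \o ((idfun \- (C \o D)) \+ (C \o (blk 0%N \o D)))) \+ (P' \o (blk 1%N \o D)).
pose T n : {linear X -> ell1} := if n is m.+1 then
  (P \o (blk m.+1 \o D)) \+ (P' \o (blk m.+2 \o D)) else T0.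
have [|n x|G Gb hG] := @glue_neighbours p q pK qK X T D M _ Db M0.
- apply: bounded_opD; last by apply: bounded_op_comp => //; exact: bounded_op_comp.
  apply: bounded_op_comp => //; apply: bounded_opD.
    by apply: bounded_opB; [exact: bounded_op_id|exact: bounded_op_comp].
  by apply: bounded_op_comp => //; exact: bounded_op_comp.
- apply: le_trans (rnormD _ _) (le_trans (lerD (PM _) (P'M _)) _).
  by rewrite -mulrDr ler_wpM2l// -addrA lerDr rnorm_ge0.
(* The inverse: x = B b_0 is recovered first, then
   z_(n+1) = (1 - P) b_n + P b_(n+1) and z_0 = D x. *)
pose Z0 : {linear ell1 -> ell1} := D \o (B \o blk 0%N).
pose Z n : {linear ell1 -> ell1} := if n is m.+1 then
  (P' \o blk m) \+ (P \o blk m.+1) else Z0.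
have [|n x|H Hb hH] := @glue_neighbours p q pK qK ell1 Z idfun M _ (bounded_op_id _) M0.
- by apply: bounded_op_comp => //; exact: bounded_op_comp.
- apply: le_trans (rnormD _ _) (le_trans (lerD (P'M _) (PM _)) _).
  by rewrite -mulrDr ler_wpM2l// lerDl rnorm_ge0.
pose S : {linear ell1 -> X} := ((idfun \- (C \o D)) \o (B \o blk 0%N)) \+ (C \o H).
have TE0 y : blk 0%N (G y) =
    A (y - C (D y) + C (blk 0%N (D y))) + (blk 1%N (D y) - A (B (blk 1%N (D y)))).
  exact: hG.
have TES y n : blk n.+1 (G y) = A (B (blk n.+1 (D y))) +
    (blk n.+2 (D y) - A (B (blk n.+2 (D y)))).
  exact: hG.
have ZE0 b : blk 0%N (H b) = D (B (blk 0%N b)) by exact: hH.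
have ZES b n : blk n.+1 (H b) = blk n b - A (B (blk n b)) + A (B (blk n.+1 b)).
  exact: hH.
have SE b : S b = B (blk 0%N b) - C (D (B (blk 0%N b))) + C (H b) by [].
have BP' z : B (z - A (B z)) = 0 by rewrite (linearB B) AK subrr.
have DQ' y : D (y - C (D y)) = 0 by rewrite (linearB D) CK subrr.
have BT0 y : B (blk 0%N (G y)) = y - C (D y) + C (blk 0%N (D y)).
  by rewrite TE0 (linearD B) AK BP' addr0.
have BTS y n : B (blk n.+1 (G y)) = B (blk n.+1 (D y)).
  by rewrite TES (linearD B) AK BP' addr0.
have HG y : H (G y) = D y.
  apply: (block_ext (pK := pK) qK) => -[|n].
    by rewrite -/(blk _) ZE0 BT0 (linearD D) DQ' CK add0r.
  rewrite -/(blk _) ZES BTS; case: n => [|n].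
    by rewrite BT0 TE0 [_ - A _]addrC addKr subrK.
  by rewrite BTS TES [_ - A _]addrC addKr subrK.
have BZS b n : B (blk n.+1 (H b)) = B (blk n.+1 b).
  by rewrite ZES (linearD B (_ - _)) BP' add0r AK.
have DS b : D (S b) = H b by rewrite SE (linearD D) DQ' add0r CK.
exists G; split=> //; exists S; split.
- move=> y; rewrite SE HG BT0 (linearD D) DQ' add0r CK addrK.
  by rewrite subrK.
- move=> b; apply: (block_ext (pK := pK) qK) => -[|n]; rewrite -/(blk _).
    rewrite TE0 DS ZE0 BZS ZES {1}SE addrK subrK.
    by rewrite addrK addrC subrK.
  by rewrite TES DS !BZS ZES addrK addrC subrK.
- apply: bounded_opD; last exact: bounded_op_comp.
  apply: bounded_op_comp; first exact: bounded_op_comp.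
  by apply: bounded_opB; [exact: bounded_op_id|exact: bounded_op_comp].
Qed.

End decomposition.

(** * Operators from ell_1 and common zeros of functionals *)

Section column_operator.
Context {R : realType} {s : scalars}.
Local Notation K := (scal R s).
Local Notation ell1 := (ell1 R s).

(** ell_1 has the universal property of a free Banach space: any bounded
    sequence is the image of the unit vectors under a bounded operator. *)
Lemma ell1_column_op (V : normedModType K) (x : nat -> V) (M : R) :
  summable_complete V -> 0 <= M -> (forall k, rnorm (x k) <= M) ->
  exists C : {linear ell1 -> V}, [/\ bounded_op C,
    forall k, C (ell1_unit k) = x k &
    forall a : ell1, series (fun i => a i *: x i) @ \oo --> C a].
Proof.
move=> Vc M0 xM.
have parE (a : ell1) n : \sum_(i < n) rnorm (a i *: x i) <= M * rnorm a.
  apply: (@le_trans _ _ (\sum_(i < n) M * modulus (a i))).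
    by apply: ler_sum => i _; rewrite rnormZ mulrC ler_wpM2r// modulus_ge0.
  by rewrite -mulr_sumr ler_wpM2l// ell1_partial_le.
pose C (a : ell1) : V := limn (series (fun i => a i *: x i)).
have Ccvg (a : ell1) : series (fun i => a i *: x i) @ \oo --> C a.
  by apply: Vc; exists (M * rnorm a); exact: parE.
have uniqC (a : ell1) l : series (fun i => a i *: x i) @ \oo --> l -> C a = l.
  by move=> h; apply/cvg_lim => //; exact: norm_hausdorff.
have lC : linear C.
  move=> c a b; apply: uniqC.
  rewrite (_ : series _ = fun n => c *: series (fun i => a i *: x i) n +
      series (fun i => b i *: x i) n).
    by apply: cvgD; [apply: cvgZr; exact: Ccvg|exact: Ccvg].
  apply/funext => n; rewrite /series /= scaler_sumr -big_split /=.
  apply: eq_bigr => i _; transitivity ((c * a i + b i) *: x i) => //.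
  by rewrite scalerDl scalerA.
exists (pack_linear lC); split.
- apply/bounded_opP; exists M => // a; apply: rnorm_cvg_le (Ccvg a) _ => n.
  apply: le_trans (parE a n); rewrite /series /= big_mkord.
  exact: rnorm_sum.
- move=> k; apply: uniqC; apply/cvg_rnormP => e e0; exists k.+1 => n kn.
  rewrite /series /= (bigD1_seq k) ?mem_index_iota ?iota_uniq//= eqxx scale1r.
  rewrite big1 ?addr0 ?subrr ?rnorm0// => i ik.
  by rewrite (negbTE ik) scale0r.
- exact: Ccvg.
Qed.

Fact ell1_coord_linear n : linear (fun a : ell1 => a n : K^o).
Proof. by []. Qed.

Definition ell1_coord n : {linear ell1 -> K^o} := pack_linear (ell1_coord_linear n).

(** Finitely many functionals have a common kernel of finite codimension: by
    induction there are n vectors v_i whose combinations correct every x into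
    the common kernel, and in an infinite-dimensional space some x is not one
    of these combinations. *)
Lemma infinite_dimensional_kernel (X : normedModType K)
    (phi : nat -> {linear X -> K^o}) n : infinite_dimensional X ->
  exists2 x, x <> 0 & forall j, (j < n)%N -> phi j x = 0.
Proof.
move=> Xinf.
suff [v hv] : exists v : 'I_n -> X, forall x, exists c : 'I_n -> K,
    forall j, (j < n)%N -> phi j (x - \sum_i c i *: v i) = 0.
  have [x hx] := Xinf n v; have [c hc] := hv x.
  by exists (x - \sum_i c i *: v i) => // /eqP; rewrite subr_eq0 => /eqP /hx.
elim: n => [|n [v hv]].
  by exists (fun=> 0) => x; exists (fun=> 0).
have wl (i : 'I_n) : widen_ord (leqnSn n) i = lift ord_max i.
  by apply: val_inj; rewrite /= /bump leqNgt ltn_ord.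
(* If phi n vanishes on the common kernel of the earlier functionals, no new
   vector is needed, and 0 is used to keep the count. *)
have [[w wn wker]|h] := pselect (exists2 w, phi n w <> 0 &
    forall j, (j < n)%N -> phi j w = 0).
  exists (fun i => oapp v w (unlift ord_max i)) => x; have [c hc] := hv x.
  pose y := x - \sum_i c i *: v i.
  exists (fun i => oapp c (phi n y / phi n w) (unlift ord_max i)) => j.
  rewrite big_ord_recr /= unlift_none /=.
  under eq_bigr => i _ do rewrite wl liftK /=.
  rewrite opprD addrA -/y linearB linearZ /= ltnS leq_eqVlt => /predU1P[->|jn].
    apply/eqP; rewrite subr_eq0; apply/eqP/esym.
    by rewrite -[LHS]/(phi n y / phi n w * phi n w) divfK//; exact/eqP.
  by rewrite (hc j)// (wker j)// [_ *: _]mulr0 subrr.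
exists (fun i => oapp v 0 (unlift ord_max i)) => x; have [c hc] := hv x.
exists (fun i => oapp c 0 (unlift ord_max i)) => j.
rewrite big_ord_recr /= unlift_none /= scaler0 addr0.
under eq_bigr => i _ do rewrite wl liftK /=.
rewrite ltnS leq_eqVlt => /predU1P[->|jn]; last exact: hc.
by apply: contrapT => hn; apply: h; exists (x - \sum_i c i *: v i).
Qed.

End column_operator.

(** * Triangular systems *)

Section triangular.
Context {R : realType} {s : scalars}.
Local Notation K := (scal R s).

(** Forward substitution for the unit lower triangular system
    b_n + sum_(j < n) M n j * b_j = c_n; only the entries of M strictly below
    the diagonal are read. *)
Fixpoint forward_subst_seq (M : nat -> nat -> K) (c : nat -> K) n : seq K :=
  if n is m.+1 then
    let b := forward_subst_seq M c m in
    rcons b (c m - \sum_(j < m) M m j * nth 0 b j)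
  else [::].

Definition forward_subst M c n : K := nth 0 (forward_subst_seq M c n.+1) n.

Lemma size_forward_subst_seq M c n : size (forward_subst_seq M c n) = n.
Proof. by elim: n => //= n IH; rewrite size_rcons IH. Qed.

Lemma nth_forward_subst_seq M c n k : (k < n)%N ->
  nth 0 (forward_subst_seq M c n) k = forward_subst M c k.
Proof.
elim: n => // n IH; rewrite ltnS leq_eqVlt => /predU1P[->//|kn].
by rewrite /= nth_rcons size_forward_subst_seq kn IH.
Qed.

Lemma forward_substE M c n :
  forward_subst M c n = c n - \sum_(j < n) M n j * forward_subst M c j.
Proof.
rewrite {1}/forward_subst /= nth_rcons size_forward_subst_seq ltnn eqxx.
by congr (_ - _); apply: eq_bigr => j _; rewrite nth_forward_subst_seq.
Qed.

Lemma forward_subst_unique (M : nat -> nat -> K) (c b : nat -> K) :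
  (forall n, b n = c n - \sum_(j < n) M n j * b j) -> b =1 forward_subst M c.
Proof.
move=> hb n; elim/ltn_ind: n => n IH; rewrite hb forward_substE.
by congr (_ - _); apply: eq_bigr => j _; rewrite IH.
Qed.

(** The strictly lower triangular part of M has ell_1 operator norm at most
    1/2, so that solving the system multiplies ell_1 norms by at most
    1 / (1 - 1/2). *)
Lemma forward_subst_le (M : nat -> nat -> K) (c : nat -> K) N :
  (forall m, \sum_(n < N | (m < n)%N) modulus (M n m) <= 2^-1) ->
  \sum_(n < N) modulus (forward_subst M c n) <= 2 * \sum_(n < N) modulus (c n).
Proof.
move=> Mle; set b := forward_subst M c; set S := \sum_(n < N) modulus (b n).
suff : S <= \sum_(n < N) modulus (c n) + 2^-1 * S by lra.
apply: (@le_trans _ _ (\sum_(n < N) (modulus (c n) +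
    \sum_(m < N | (m < n)%N) modulus (M n m) * modulus (b m)))).
  apply: ler_sum => n _; rewrite /b forward_substE -/b.
  apply: le_trans (modulusD _ _) _; rewrite modulusN lerD2l.
  have -> : \sum_(m < N | (m < n)%N) modulus (M n m) * modulus (b m) =
      \sum_(m < n) modulus (M n m) * modulus (b m).
    by rewrite -(big_ord_widen _ (fun m => modulus (M n m) * modulus (b m)) (ltnW (ltn_ord n))).
  apply: (big_ind2 (fun (x : K) y => modulus x <= y)); first by rewrite modulus0.
    by move=> x y u v xy uv; apply: le_trans (modulusD _ _) (lerD xy uv).
  by move=> i _; rewrite modulusM.
rewrite big_split /= lerD2l (exchange_big_dep xpredT) //= /S mulr_sumr.
by apply: ler_sum => m _; rewrite -mulr_suml ler_wpM2r ?modulus_ge0.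
Qed.

Lemma forward_subst_linear (M : nat -> nat -> K) (a : K) (c c' : nat -> K) n :
  forward_subst M (fun n => a * c n + c' n) n =
  a * forward_subst M c n + forward_subst M c' n.
Proof.
apply/esym; move: n; apply: forward_subst_unique => n.
rewrite !forward_substE mulrBr mulr_sumr addrACA -opprD -big_split /=.
by congr (_ - _); apply: eq_bigr => j _; rewrite mulrDr !mulrA (mulrC a).
Qed.

End triangular.

(** * A complemented copy of ell_1 by gliding humps *)

Section gliding_hump.
Context {R : realType} {s : scalars}.
Local Notation K := (scal R s).
Local Notation ell1 := (ell1 R s).
Variables (X : normedModType K) (A : {linear X -> ell1}) (B : {linear ell1 -> X}).
Hypotheses (Ab : bounded_op A) (Bb : bounded_op B) (AK : cancel A B).
Hypothesis Xinf : infinite_dimensional X.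

(** Take a nonzero x killed by the first n coordinates, and m so large that the
    coordinates of A x in [n, m[ carry more than 2/3 of its norm; rescaling
    them to total mass 1 leaves a tail of mass at most 1/2. *)
Lemma gliding_hump n : exists (mx : nat * X), [/\ (n <= mx.1)%N,
  forall j, (j < n)%N -> A mx.2 j = 0,
  \sum_(n <= j < mx.1) modulus (A mx.2 j) = 1 &
  rnorm (A mx.2) <= 3 / 2].
Proof.
have [x x0 hx] := infinite_dimensional_kernel
  (fun j => ell1_coord j \o A) n Xinf.
have T0 : 0 < rnorm (A x).
  rewrite lt_neqAle rnorm_ge0 andbT eq_sym; apply/eqP => /rnorm_eq0 Ax0.
  by apply: x0; rewrite -(AK x) Ax0 linear0.
have [|m hm] := @ell1_partial_gt _ _ (A x) (2 / 3 * rnorm (A x)); first lra.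
set p := \sum_(i < m) modulus (A x i) in hm.
have p0 : 0 < p by apply: lt_trans hm; rewrite mulr_gt0// divr_gt0.
have nm : (n <= m)%N.
  rewrite leqNgt; apply/negP => mn; suff : p = 0 by move=> p00; rewrite p00 ltxx in p0.
  apply: big1 => i _; rewrite [A x i]hx ?modulus0//.
  exact: ltn_trans (ltn_ord i) mn.
exists (m, scal_real p^-1 *: x); split => //=.
- by move=> j jn; rewrite linearZ ell1_scaleE [A x j]hx// mulr0.
- under eq_bigr do rewrite linearZ ell1_scaleE modulusM modulus_real.
  rewrite -mulr_sumr; suff -> : \sum_(n <= i < m) modulus (A x i) = p.
    by rewrite ger0_norm ?invr_ge0 ?ltW// mulVf// gt_eqF.
  rewrite /p -(big_mkord xpredT (fun i => modulus (A x i))).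
  rewrite [RHS](big_cat_nat (n := n))//= [X in _ = X + _](_ : _ = 0) ?add0r//.
  by rewrite big_nat big1// => i /andP[_ ni]; rewrite [A x i]hx ?modulus0.
- rewrite linearZ rnormZ modulus_real ger0_norm ?invr_ge0 ?(ltW p0)//.
  rewrite ler_pdivrMl//; lra.
Qed.

(** C sends the k-th unit vector to the k-th hump x_k. Pairing A y with
    conjugate signs of A x_k on the k-th interval gives functionals c_k with sum_k |c_k y| at
    most |A y|. The matrix M n m = c_n x_m has 1 on the diagonal, 0 above it and
    columns of mass at most 1/2 below it, so that solving the corresponding
    triangular system turns the c_k into the coordinates of a left inverse of
    C. *)
Lemma ell1_complemented_copy : summable_complete X ->
  exists (C : {linear ell1 -> X}) (D : {linear X -> ell1}),
    [/\ bounded_op C, bounded_op D & cancel C D].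
Proof.
move=> Xc; have [F hF] := choice gliding_hump.
pose N k := iter k (fun n => (F n).1) 0%N.
pose x k := (F (N k)).2.
have Nle k : (N k <= N k.+1)%N by have [] := hF (N k).
have xlow k j : (j < N k)%N -> A (x k) j = 0 by have [_ + _ _] := hF (N k); apply.
have xmid k : \sum_(N k <= j < N k.+1) modulus (A (x k) j) = 1.
  by have [_ _ + _] := hF (N k).
have xle k : rnorm (A (x k)) <= 3 / 2 by have [] := hF (N k).
have Nmono a b : (a <= b)%N -> (N a <= N b)%N.
  by apply: (homo_leq (r := leq)) => // ? ? ?; exact: leq_trans.
have tele (u : nat -> R) a b : (a <= b)%N ->
    \sum_(a <= n < b) \sum_(N n <= j < N n.+1) u j = \sum_(N a <= j < N b) u j.
  elim: b => [|b IH]; first by rewrite leqn0 => /eqP ->; rewrite !big_geq.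
  rewrite leq_eqVlt => /predU1P[->|]; first by rewrite !big_geq.
  rewrite ltnS => ab; rewrite big_nat_recr//= IH//.
  by rewrite [RHS](big_cat_nat (n := N b)) ?Nmono.
(* Weights of modulus at most 1 that turn the k-th hump into its mass. *)
pose th k j : K := `|A (x k) j : K| / A (x k) j.
have thle k j : modulus (th k j) <= 1.
  rewrite /th; have [->|nz] := eqVneq (A (x k) j : K) 0.
    by rewrite normr0 mul0r modulus0.
  by rewrite -(ler_scal_real (s := s)) -norm_scal
    normrM normfV normr_id divff ?normr_eq0// scal_real1.
pose c k (y : X) : K := \sum_(N k <= j < N k.+1) th k j * A y j.
have cle k y : modulus (c k y) <= \sum_(N k <= j < N k.+1) modulus (A y j).
  apply: (big_ind2 (fun (u : K) v => modulus u <= v)); first by rewrite modulus0.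
    by move=> ? ? ? ? h1 h2; apply: le_trans (modulusD _ _) (lerD h1 h2).
  by move=> j _; rewrite modulusM -[leRHS]mul1r ler_wpM2r ?modulus_ge0.
have cP k (a : K) y z : c k (a *: y + z) = a * c k y + c k z.
  rewrite /c mulr_sumr -big_split /=; apply: eq_bigr => j _.
  by rewrite linearP ell1_addE ell1_scaleE mulrDr mulrCA; exact: erefl.
pose M n m := c n (x m).
have Mdiag k : M k k = 1.
  rewrite /M /c -scal_real1 -(xmid k) (big_morph _ (@scal_realD R s) (@scal_real0 R s)).
  apply: eq_bigr => j _; rewrite -norm_scal /th.
  have [->|nz] := eqVneq (A (x k) j : K) 0; first by rewrite normr0 mulr0.
  by rewrite divfK.
have Mup n m : (n < m)%N -> M n m = 0.
  move=> nm; rewrite /M /c big_nat big1// => j /andP[_ jn].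
  by rewrite xlow ?mulr0// (leq_trans jn)// Nmono.
have Mlow L m : \sum_(n < L | (m < n)%N) modulus (M n m) <= 2^-1.
  rewrite -(big_mkord (fun n => m < n)%N (fun n => modulus (M n m))).
  rewrite -(big_nat_widenl m.+1 0%N L xpredT)//.
  have [Lm|mL] := leqP L m; first by rewrite big_geq 1?ltnW// invr_ge0.
  apply: le_trans (ler_sum _ (fun n _ => cle n (x m))) _; rewrite tele//.
  have := ell1_partial_le (A (x m)) (N L).
  rewrite -(big_mkord xpredT (fun j => modulus (A (x m) j))).
  rewrite (big_cat_nat (n := N m)) ?(Nmono _ _ (ltnW mL))//=.
  rewrite (big_cat_nat (n := N m.+1) (m := N m)) ?Nmono//= xmid.
  have : 0 <= \sum_(0 <= i < N m) modulus (A (x m) i).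
    by apply: sumr_ge0 => i _; exact: modulus_ge0.
  by have := xle m; lra.
have /bounded_opP[MA MA0 hA] := Ab; have /bounded_opP[MB MB0 hB] := Bb.
have bsum y L : \sum_(n < L) modulus (forward_subst M (c ^~ y) n) <= 2 * MA * rnorm y.
  apply: le_trans (forward_subst_le (c ^~ y) (Mlow L)) _.
  rewrite -mulrA ler_wpM2l//; apply: le_trans (hA y).
  apply: le_trans (ler_sum _ (fun n _ => cle (val n) y)) _.
  rewrite -(big_mkord xpredT (fun n => \sum_(N n <= j < N n.+1) modulus (A y j))).
  by rewrite tele// big_mkord; exact: ell1_partial_le.
pose D y : ell1 := Ell1 (ell1_mem (bsum y)).
have DE y n : D y n = forward_subst M (c ^~ y) n by [].
have lD : linear D.
  move=> a y z; apply: ell1_eq => n; rewrite ell1_addE ell1_scaleE !DE.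
  by rewrite -forward_subst_linear; congr forward_subst; apply/funext => k.
have Db : bounded_op D.
  apply/bounded_opP; exists (2 * MA) => [|y]; first exact: mulr_ge0.
  by apply: ell1_norm_le => n; exact: bsum.
have [||C [Cb CE _]] := @ell1_column_op _ _ X x (MB * (3 / 2)) Xc.
- by rewrite mulr_ge0// divr_ge0.
- by move=> k; rewrite -[x k]AK (le_trans (hB _))// ler_wpM2l.
exists C, (pack_linear lD); split => //.
apply: (@bounded_op_ell1_eq _ _ _ (pack_linear lD \o C) idfun) => [||k].
- exact: bounded_op_comp.
- exact: bounded_op_id.
rewrite /= CE; apply: ell1_eq => n; rewrite DE; apply/esym.
move: n; apply: forward_subst_unique => n /=; rewrite -/(M n k).
rewrite (eq_bigr (fun j : 'I_n => if val j == k then M n k else 0)); last first.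
  by move=> j _; case: eqP => [->|]; rewrite ?mulr1 ?mulr0.
rewrite sum_kronecker; case: (ltngtP n k) => [nk|nk|->].
- by rewrite Mup// subr0.
- by rewrite subrr.
- by rewrite Mdiag subr0.
Qed.

End gliding_hump.

(** * Unconditional convergence *)

Section unconditional.
Context {R : realType} {s : scalars}.
Local Notation K := (scal R s).
Variable V : normedModType K.

(** Given finite sets r n contained in [n, oo[, a permutation of nat is built which
    permutes each interval [N k, N k.+1[ separately and lists r (N k) first there.
    Partial sums of the rearranged series then differ by the sum over
    r (N k). *)
Section rearrangement.
Variables (r : nat -> seq nat).
Hypotheses (r_uniq : forall n, uniq (r n)).
Hypotheses (r_ge : forall n i, i \in r n -> (n <= i)%N).

Let next n := (\max_(i <- r n) i + n).+1.
Let blk n := r n ++ [seq i <- iota n (next n - n) | i \notin r n].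

Let blk_perm n : perm_eq (blk n) (iota n (next n - n)).
Proof.
apply: uniq_perm; rewrite ?iota_uniq// /blk.
  rewrite cat_uniq r_uniq filter_uniq ?iota_uniq// andbT /=.
  by apply/hasPn => i; rewrite mem_filter => /andP[].
move=> i; rewrite mem_cat mem_filter mem_iota.
have [ir|//] := boolP (i \in r n); rewrite /= r_ge//= subnKC; last first.
  by rewrite /next ltnW// ltnS leq_addl.
rewrite /next ltnS (leq_trans _ (leq_addr _ _))//.
exact: leq_bigmax_seq.
Qed.

Fixpoint rearr_start k := if k is k'.+1 then next (rearr_start k') else 0%N.
Fixpoint rearr_prefix k : seq nat :=
  if k is k'.+1 then rearr_prefix k' ++ blk (rearr_start k') else [::].
Local Notation N := rearr_start.
Local Notation L := rearr_prefix.

Let next_gt n : (n < next n)%N. Proof. by rewrite /next ltnS leq_addl. Qed.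

Lemma rearr_start_ge k : (k <= N k)%N.
Proof. by elim: k => //= k IH; exact: leq_ltn_trans IH (next_gt _). Qed.

Lemma rearr_prefix_perm k : perm_eq (L k) (iota 0 (N k)).
Proof.
elim: k => [//|k IH]; rewrite -[N k.+1](subnKC (ltnW (next_gt (N k)))).
by rewrite iotaD add0n perm_cat.
Qed.

Let size_prefix k : size (L k) = N k.
Proof. by rewrite (perm_size (rearr_prefix_perm k)) size_iota. Qed.

Let uniq_prefix k : uniq (L k).
Proof. by rewrite (perm_uniq (rearr_prefix_perm k)) iota_uniq. Qed.

Let mem_prefix k i : (i \in L k) = (i < N k)%N.
Proof. by rewrite (perm_mem (rearr_prefix_perm k)) mem_iota. Qed.

Let prefix_cat a c : exists t, L (c + a) = L a ++ t.
Proof.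
elim: c => [|c [t ht]]; first by exists [::]; rewrite cats0.
by exists (t ++ blk (N (c + a))); rewrite addSn /= ht catA.
Qed.

Let nth_prefix a b j : (j < N a)%N -> (a <= b)%N -> nth 0%N (L b) j = nth 0%N (L a) j.
Proof.
move=> ja ab; have [t] := prefix_cat a (b - a); rewrite subnK// => ->.
by rewrite nth_cat size_prefix ja.
Qed.

Let index_prefix a b i : (i < N a)%N -> (a <= b)%N -> index i (L b) = index i (L a).
Proof.
move=> ia ab; have [t] := prefix_cat a (b - a); rewrite subnK// => ->.
by rewrite index_cat mem_prefix ia.
Qed.

Definition rearr j := nth 0%N (L j.+1) j.

Lemma rearrE k j : (j < N k)%N -> rearr j = nth 0%N (L k) j.
Proof.
move=> jk; rewrite /rearr; have [jk1|kj] := leqP j.+1 k.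
  by rewrite [RHS](nth_prefix _ jk1)// rearr_start_ge.
by rewrite (nth_prefix jk (ltnW kj)).
Qed.

Lemma rearr_bij : bijective rearr.
Proof.
exists (fun i => index i (L i.+1)) => [j|i].
  set i := rearr j; pose c := maxn i.+1 j.+1.
  rewrite -(@index_prefix i.+1 c) ?rearr_start_ge ?leq_maxl//.
  have jc : (j < N c)%N by apply: leq_trans (rearr_start_ge _); rewrite leq_maxr.
  by rewrite /i (rearrE jc) index_uniq ?size_prefix.
have iN : (i < N i.+1)%N by exact: rearr_start_ge.
by rewrite (@rearrE i.+1) ?nth_index ?mem_prefix// -size_prefix index_mem mem_prefix.
Qed.

Lemma rearr_block (x : nat -> V) k :
  series (x \o rearr) (N k + size (r (N k)))%N - series (x \o rearr) (N k) =
  \sum_(i <- r (N k)) x i.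
Proof.
have serE l a : (l <= N a)%N -> series (x \o rearr) l = \sum_(i <- take l (L a)) x i.
  move=> la; rewrite /series /= [RHS](big_nth 0%N) size_take size_prefix.
  rewrite (_ : (if _ then _ else _) = l); last by case: ltngtP la.
  rewrite big_nat [RHS]big_nat; apply: eq_bigr => j jl.
  by rewrite nth_take// (@rearrE a)// (leq_trans jl).
have sz : (size (r (N k)) <= size (blk (N k)))%N by rewrite size_cat leq_addr.
rewrite (serE _ k.+1); last by rewrite -(size_prefix k.+1) /= size_cat size_prefix leq_add2l.
rewrite (serE _ k)// [take _ (L k)]take_oversize ?size_prefix//= takeD big_cat /=.
rewrite take_size_cat ?size_prefix// drop_size_cat ?size_prefix//.
by rewrite take_size_cat// addrAC subrr add0r.
Qed.

End rearrangement.

(** Otherwise there are finite sets arbitrarily far out with sums of norm at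
    least e, and a rearrangement listing infinitely many of them consecutively
    is not Cauchy. *)
Lemma unconditional_small_tails (x : nat -> V) (e : R) :
  unconditionally_convergent x -> 0 < e ->
  exists n, forall r, uniq r -> (forall i, i \in r -> (n <= i)%N) ->
    rnorm (\sum_(i <- r) x i) < e.
Proof.
move=> xu e0; apply: contrapT => h.
have /choice[r hr] : forall n, exists r, [/\ uniq r,
    (forall i, i \in r -> (n <= i)%N) & e <= rnorm (\sum_(i <- r) x i)].
  move=> n; apply: contrapT => hn; apply: h; exists n => r ur rn.
  by rewrite ltNge; apply/negP => er; apply: hn; exists r.
have ru n : uniq (r n) by have [] := hr n.
have rge n i : i \in r n -> (n <= i)%N by have [_ + _] := hr n; apply.
have /cvg_ex[l /cvg_rnormP hl] := xu _ (rearr_bij ru rge).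
have [|k hk] := hl (e / 2); first by rewrite divr_gt0.
have [_ _] := hr (rearr_start r k); rewrite -(rearr_block ru rge) leNgt => /negP; apply.
set a := series _ _; set b := series _ _.
have -> : a - b = (l - b) - (l - a) by rewrite opprB [RHS]addrC addrA subrK.
apply: le_lt_trans (rnormB _ _) _.
have kN : (k <= rearr_start r k)%N by exact: rearr_start_ge.
have ha := hk _ (leq_trans kN (leq_addr (size (r (rearr_start r k))) _)).
by have hb := hk _ kN; rewrite [ltRHS](splitr e) ltrD.
Qed.

End unconditional.

(** * Uniform boundedness *)

Section uniform_boundedness.
Context {R : realType} {s : scalars}.
Local Notation K := (scal R s).
Variables (V : normedModType K) (q : nat -> V -> R).
Hypotheses (Vc : summable_complete V)
  (qD : forall n x y, q n (x + y) <= q n x + q n y)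
  (qZ : forall n (a : K) x, q n (a *: x) = modulus a * q n x)
  (q_bounded : forall n, exists M, forall x, q n x <= M * rnorm x)
  (q_pointwise : forall x, exists M, forall n, q n x <= M).

Let q0 n : q n 0 = 0.
Proof. by rewrite -(scale0r 0) qZ modulus0 mul0r. Qed.

Let qN n x : q n (- x) = q n x.
Proof. by rewrite -scaleN1r qZ modulusN modulus1 mul1r. Qed.

Lemma sum_half_le a n : \sum_(a <= j < n) (2^-1 : R) ^+ j <= 2 * 2^-1 ^+ a.
Proof.
have [na|an] := leqP n a; first by rewrite big_geq// mulr_ge0// exprn_ge0// invr_ge0.
have -> : \sum_(a <= j < n) (2^-1 : R) ^+ j = 2 * (2^-1 ^+ a - 2^-1 ^+ n).
  elim: n an => // n IH; rewrite ltnS => an; rewrite big_nat_recr//=.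
  move: an; rewrite leq_eqVlt => /predU1P[->|an].
    by rewrite big_geq// exprS; field.
  by rewrite IH// exprS; field.
by rewrite ler_wpM2l// gerBl exprn_ge0// invr_ge0.
Qed.

(** By a gliding hump. If no bound holds, one builds
    l = sum_k y_k and indices n_k such that q_(n_k) is at least k on the partial
    sum ending with y_k, while the later terms are so small that q_(n_k) changes
    by at most 2 from there on. *)
Lemma uniform_boundedness : exists2 M : R, 0 <= M & forall n x, q n x <= M * rnorm x.
Proof.
apply: contrapT => hq.
(* t holds the partial sum reached and a bound C for the seminorms used so
   far; y.2 is the updated bound. *)
have step (k : nat) (t : V * R) : exists (y : V * R), 0 <= t.2 ->
    [/\ rnorm y.1 <= 2^-1 ^+ k / (1 + t.2), t.2 <= y.2 &
    exists n, k%:R <= q n (t.1 + y.1) /\ forall x, q n x <= y.2 * rnorm x].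
  case: t => t C /=; have [C0|C0] := leP 0 C; last by exists (0, 0).
  set e := 2^-1 ^+ k / (1 + C).
  have e0 : 0 < e by rewrite divr_gt0 ?exprn_gt0 ?invr_gt0// ltr_pwDl.
  have [n [x qx]] : exists n x, k%:R / e * rnorm x < q n x.
    apply: contrapT => h; apply: hq; exists (k%:R / e).
      by rewrite divr_ge0// ltW.
    by move=> n x; rewrite leNgt; apply/negP => nx; apply: h; exists n, x.
  have x0 : 0 < rnorm x.
    rewrite lt_neqAle rnorm_ge0 andbT eq_sym; apply/eqP => /rnorm_eq0 x0.
    by move: qx; rewrite x0 rnorm0 mulr0 q0 ltxx.
  pose y : V := scal_real (e / rnorm x) *: x.
  have ex0 : 0 < e / rnorm x by rewrite divr_gt0.
  have ye : rnorm y = e.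
    by rewrite rnormZ modulus_real gtr0_norm// divfK// gt_eqF.
  have qy : k%:R <= q n y.
    rewrite qZ modulus_real gtr0_norm//.
    apply: le_trans (ler_wpM2l (ltW ex0) (ltW qx)).
    rewrite (_ : _ * _ = k%:R)//; by field; rewrite !gt_eqF.
  have [M qM] := q_bounded n.
  have qMC x' : q n x' <= (C + `|M|) * rnorm x'.
    apply: le_trans (qM x') _; rewrite ler_wpM2r ?rnorm_ge0//.
    by rewrite (le_trans (ler_norm _))// lerDr.
  (* One of t + y and t - y has seminorm at least q n y, as 2 y is their
     difference. *)
  have [ty|ty] := leP (q n y) (q n (t + y)).
    exists (y, C + `|M|) => _ /=; rewrite ye lexx lerDl normr_ge0; split=> //.
    by exists n; split=> //; exact: le_trans ty.
  exists (- y, C + `|M|) => _ /=; rewrite rnormN ye lexx lerDl normr_ge0; split=> //.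
  exists n; split=> //; apply: le_trans qy _.
  have : q n y *+ 2 <= q n (t + y) + q n (t - y).
    rewrite -[q n (t - y)]qN; apply: le_trans (qD n (t + y) (- (t - y))).
    have -> : t + y - (t - y) = scal_real 2 *: y.
      rewrite opprB addrC subrKA (_ : 2 = 1 + 1 :> R)// scal_realD scal_real1.
      by rewrite scalerDl scale1r.
    by rewrite qZ modulus_real ger0_norm// mulr_natl.
  by rewrite mulr2n => h; move: ty h; lra.
have [F hF] := choice (fun kt : nat * (V * R) => step kt.1 kt.2).
pose st := fix st k : V * R := if k is k'.+1 then
  let t := st k' in let y := F (k', t) in (t.1 + y.1, y.2) else (0, 0).
pose y k := (F (k, st k)).1; pose C k := (st k).2.
have C0 k : 0 <= C k.
  by elim: k => // k IH; have [_ + _] := hF (k, st k) IH; exact: le_trans.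
have ylt k : rnorm (y k) <= 2^-1 ^+ k / (1 + C k) by have [] := hF (k, st k) (C0 k).
have Cle a b : (a <= b)%N -> C a <= C b.
  apply: (homo_leq (r := <=%R)) => // [? ? ?|k]; first exact: le_trans.
  by have [] := hF (k, st k) (C0 k).
have stE k : (st k).1 = series y k.
  by rewrite /series /=; elim: k => [|k IH]; [rewrite big_geq|rewrite big_nat_recr//= IH].
have tail k n : rnorm (\sum_(k <= j < n) y j) <= 2 * 2^-1 ^+ k / (1 + C k).
  apply: le_trans (rnorm_sum _ _ _) _.
  have Ck : 0 < 1 + C k by rewrite ltr_pwDl.
  apply: (@le_trans _ _ (\sum_(k <= j < n) 2^-1 ^+ j / (1 + C k))).
    rewrite big_nat [leRHS]big_nat; apply: ler_sum => j /andP[kj _].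
    apply: le_trans (ylt j) _; rewrite ler_wpM2l ?exprn_ge0 ?invr_ge0//.
    by rewrite lef_pV2 ?posrE ?lerD2l ?Cle// ltr_pwDl.
  by rewrite -mulr_suml ler_wpM2r ?invr_ge0 ?(ltW Ck)// sum_half_le.
have /cvg_ex[l yl] : cvgn (series y).
  apply: Vc; exists 2 => n; rewrite -(big_mkord xpredT (fun i => rnorm (y i))).
  have := sum_half_le 0 n; rewrite expr0 mulr1; apply: le_trans.
  apply: ler_sum => j _; apply: le_trans (ylt j) _.
  by rewrite ler_pdivrMr ?ltr_pwDl// ler_peMr ?exprn_ge0 ?invr_ge0// lerDl.
have qlarge k : exists n, k%:R - 2 <= q n l.
  have [_ _ [n [nk nC]]] := hF (k, st k) (C0 k); exists n.
  have sE : (st k).1 + y k = series y k.+1 by rewrite -stE.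
  set sk := series y k.+1 in sE; rewrite sE in nk.
  have lk : rnorm (l - sk) <= 2 * 2^-1 ^+ k.+1 / (1 + C k.+1).
    apply: (@rnorm_cvg_le _ _ _ (fun n => series y (n + k.+1)%N - sk)).
      by apply: cvgB; [rewrite (cvg_shiftn k.+1)|exact: cvg_cst].
    by move=> m; rewrite sub_series_geq ?leq_addl//; exact: tail.
  have : q n (l - sk) <= 2.
    apply: le_trans (nC _) _; apply: le_trans (ler_wpM2l (C0 k.+1) lk) _.
    have Ck : 0 < 1 + C k.+1 by rewrite ltr_pwDl.
    rewrite mulrA ler_pdivrMr// mulrCA ler_wpM2l// mulrC.
    apply: (@le_trans _ _ (1 * C k.+1)); last by rewrite mul1r lerDr.
    by rewrite ler_wpM2r// exprn_ile1 ?invr_ge0// invf_le1 ?ler1n.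
  have : q n sk <= q n l + q n (l - sk).
    by rewrite -(qN n (l - sk)); apply: le_trans (qD _ _ _); rewrite opprB addrC subrK.
  by move: nk; lra.
have [M hM] := q_pointwise l.
have [n hn] := qlarge (Num.bound (`|M| + 2)).
have := @archi_boundP _ (`|M| + 2) (addr_ge0 (normr_ge0 _) (ler0n _ 2)).
by have := hM n; have := ler_norm M; lra.
Qed.

End uniform_boundedness.

(** * Translation invariance of Lebesgue measure *)

Section translation.
Context {R : realType}.

Lemma lebesgue_measure_addr (a : R) (A : set (measurableTypeR R)) :
  measurable A ->
  lebesgue_measure ((fun x : measurableTypeR R => x + a : measurableTypeR R) @^-1` A) =
  lebesgue_measure A.
Proof.
have mf : measurable_fun setT (fun x : measurableTypeR R => x + a : measurableTypeR R).
  by apply: measurable_funD => //; exact: measurable_cst.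
move=> mA; apply/esym.
rewrite -[RHS]/(pushforward lebesgue_measure
  (fun x : measurableTypeR R => x + a : measurableTypeR R) A).
apply: lebesgue_measure_unique mA => //= _ [[u v]] _ <-.
rewrite /pushforward (_ : _ @^-1` _ = `]u - a, v - a]%classic); last first.
  by apply/seteqP; split=> x /=; rewrite !in_itv/= ltrBlDr lerBrDr.
rewrite !lebesgue_measure_itv /= !lte_fin ltrD2r.
by case: ifP => // _; rewrite -!EFinB; congr EFin; rewrite opprB addrA subrK.
Qed.

Lemma measurable_addr_rV d (a : 'rV[R]_d) :
  measurable_fun setT (fun x : 'rV[R]_d => x + a).
Proof.
apply: measurable_fun_rV => i; under eq_fun do rewrite mxE.
by apply: measurable_funD; [exact: measurable_coord|exact: measurable_cst].
Qed.

(** Translation commutes with splitting off the first coordinate, so the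
    translated measure agrees with the product measure on rectangles. *)
Lemma lebesgue_rV_addr d (a : 'rV[R]_d) (A : set 'rV[R]_d) : measurable A ->
  lebesgue_rV d ((fun x => x + a) @^-1` A) = lebesgue_rV d A.
Proof.
elim: d a A => [|d IH] a A mA.
  by congr (lebesgue_rV 0 _); apply/seteqP; split=> x /=; rewrite (thinmx0 a) addr0.
pose a' : 'rV[R]_d := \row_j a 0 (lift ord0 j).
pose tr (p : measurableTypeR R * 'rV[R]_d) : measurableTypeR R * 'rV[R]_d :=
  (p.1 + a 0 ord0, p.2 + a').
have mtr : measurable_fun setT tr.
  apply/measurable_fun_pair.
    by apply: measurable_funD => //; exact: measurable_cst.
  by apply: (measurableT_comp (measurable_addr_rV a')); exact: measurable_snd.
rewrite /= /lebesgue_cons /pushforward -comp_preimage.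
have -> : (fun x => x + a) \o @cons_rV R d = @cons_rV R d \o tr.
  apply/funext => p; apply/rowP => i; rewrite /= !mxE.
  by case: unliftP => [j|] -> //=; rewrite !mxE.
rewrite comp_preimage; set B := _ @^-1` A.
have mB : measurable B by rewrite -[B]setTI; exact: measurable_cons_rV.
rewrite -[LHS]/(pushforward (lebesgue_measure \x lebesgue_rV d)%E tr B).
apply/esym; apply: product_measure_unique => // C D mC mD.
rewrite -[LHS]/((lebesgue_measure \x lebesgue_rV d)%E (tr @^-1` (C `*` D))) (_ : tr @^-1` _ = ((fun x : measurableTypeR R =>
  x + a 0 ord0 : measurableTypeR R) @^-1` C) `*` ((fun x => x + a') @^-1` D)) //.
rewrite product_measure1E ?IH//.
- by congr (_ * _)%E; exact: lebesgue_measure_addr.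
- rewrite -[X in measurable X]setTI.
  have : measurable_fun setT (fun x : measurableTypeR R => x + a 0 ord0 : measurableTypeR R).
    by apply: measurable_funD => //; exact: measurable_cst.
  exact.
- by rewrite -[X in measurable X]setTI; exact: measurable_addr_rV.
Qed.

Lemma ge0_integral_translate d (a : 'rV[R]_d) (h : 'rV[R]_d -> \bar R) (D : set 'rV[R]_d) :
  measurable D -> measurable_fun setT h -> (forall x, 0 <= h x)%E ->
  (\int[lebesgue_rV d]_(x in (fun x => x - a)%R @^-1` D) h (x - a)%R =
   \int[lebesgue_rV d]_(x in D) h x)%E.
Proof.
move=> mD mh h0.
rewrite -(ge0_integral_pushforward (measurable_addr_rV (- a))
  (lebesgue_rV d : {measure set 'rV[R]_d -> \bar R}) mD) //; last exact: measurable_funTS.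
apply: eq_measure_integral => [|? A mA _]; first exact: measurable_addr_rV.
exact: lebesgue_rV_addr.
Qed.

End translation.

(** * Small sets of positive mass *)

Section cells.
Context {R : realType} (d : nat).
Local Notation mu := (lebesgue_rV d : {measure set 'rV[R]_d -> \bar R}).

Definition cell (c : R) (z : {ffun 'I_d -> int}) : set 'rV[R]_d :=
  [set x | forall j, (z j)%:~R <= c * x 0 j < (z j)%:~R + 1].

Lemma measurable_cell c z : measurable (cell c z).
Proof.
rewrite (_ : cell c z = \bigcap_(j in [set: 'I_d])
    ((fun x : 'rV[R]_d => c * x 0 j : measurableTypeR R) @^-1`
      `[(z j)%:~R, (z j)%:~R + 1[%classic)); last first.
  apply/seteqP; split=> x /= h j; first by move=> _; rewrite /= in_itv; exact: h.
  by have := h j Logic.I; rewrite /= in_itv.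
apply: fin_bigcap_measurable => // j _; rewrite -[X in measurable X]setTI.
have : measurable_fun setT (fun x : 'rV[R]_d => c * x 0 j : measurableTypeR R).
  by apply: measurable_funM; [exact: measurable_cst|exact: measurable_coord].
by apply=> //=; exact: measurable_itv.
Qed.

Lemma cell_cover c x : exists z, cell c z x.
Proof.
exists [ffun j => Num.floor (c * x 0 j)] => j; rewrite ffunE.
by rewrite ge_floor/= -intrD1 floorD1_gt.
Qed.

Lemma cell_diameter (delta c : R) z x y : 0 < delta -> d.+1%:R <= c * delta ->
  0 < c -> cell c z x -> cell c z y -> euclidean_norm (x - y) < delta.
Proof.
move=> delta0 cd c0 zx zy; rewrite /euclidean_norm.
have -> : delta = Num.sqrt (delta ^+ 2) by rewrite sqrtr_sqr gtr0_norm.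
rewrite ltr_sqrt ?exprn_gt0//.
have le j : ((x - y) 0 j) ^+ 2 <= c^-1 ^+ 2.
  have /andP[x1 x2] := zx j; have /andP[y1 y2] := zy j.
  have : `|c * (x 0 j - y 0 j)| <= 1 by rewrite ler_norml; lra.
  rewrite normrM (gtr0_norm c0) mulrC -ler_pdivlMr// mul1r => h.
  by rewrite !mxE -real_normK ?num_real// ler_sqr ?nnegrE// invr_ge0 ltW.
apply: (@le_lt_trans _ _ (\sum_(j < d) c^-1 ^+ 2)); first exact: ler_sum.
rewrite sumr_const card_ord -mulr_natl.
have h1 : d%:R < (c * delta) ^+ 2.
  apply: lt_le_trans (_ : d.+1%:R <= _); first by rewrite ltr_nat.
  apply: (le_trans cd); rewrite ler_eXnr//.
  by apply: (le_trans _ cd); rewrite ler1n.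
by rewrite exprVn ltr_pdivrMr ?exprn_gt0// mulrC -exprMn.
Qed.

(** The cells of a fine enough cubic grid form a countable cover; if h had mass
    zero on each of them it would vanish almost everywhere. *)
Lemma positive_cell (h : 'rV[R]_d -> R) (delta : R) : 0 < delta ->
  measurable_fun setT h -> (forall x, 0 <= h x) ->
  (\int[mu]_x (h x)%:E != 0)%E ->
  exists Q : set 'rV[R]_d, [/\ measurable Q,
    forall x y, Q x -> Q y -> euclidean_norm (x - y) < delta &
    (0 < \int[mu]_(x in Q) (h x)%:E)%E].
Proof.
move=> delta0 mh h0 hn0.
(* A cell has sides 1/c, hence Euclidean diameter at most
   sqrt(d) / c < delta. *)
pose c := d.+1%:R / delta.
have c0 : 0 < c by rewrite divr_gt0.
pose Q n := if unpickle n is Some z then cell c z else set0.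
apply: contrapT => nQ; move/eqP: hn0; apply.
have mh' : measurable_fun setT (fun x => (h x)%:E) by exact/measurable_EFinP.
have Q0 n : (mu.-negligible (~` [set x | Q n x -> (h x)%:E = 0%E]))%E.
  have mQ : measurable (Q n) by rewrite /Q; case: unpickle => // z; exact: measurable_cell.
  have mhQ : measurable_fun (Q n) (fun x => (h x)%:E) by exact: measurable_funTS.
  have [+ _] := ae_eq_integral_abs mu mQ mhQ; apply.
  transitivity (\int[mu]_(x in Q n) (h x)%:E)%E.
    by apply: eq_integral => x _; rewrite /= ger0_norm.
  apply/eqP; rewrite eq_le integral_ge0 ?andbT; last by move=> x _; rewrite lee_fin.
  rewrite leNgt; apply/negP => pos; apply: nQ; exists (Q n); split=> // x y.
  rewrite /Q; case: unpickle => // z; apply: cell_diameter => //.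
  by rewrite /c divfK// gt_eqF.
have hae : ae_eq mu setT (fun x => (h x)%:E) (cst 0%E).
  apply: negligibleS (negligible_bigcup Q0) => x /= hx.
  have [z zx] := cell_cover c x; exists (pickle z) => //= hz; apply: hx => _.
  by apply: hz; rewrite /Q pickleK.
have [_ /(_ hae)] := ae_eq_integral_abs mu measurableT mh'.
by move=> <-; apply: eq_integral => x _; rewrite /= ger0_norm.
Qed.

End cells.

(** * Subset sums against disjoint sets *)

Section subset_sums.
Context {R : realType} {s : scalars}.
Local Notation K := (scal R s).

(** Pair each G with the set obtained by adding or removing i: the two sums
    differ by b_i, so one of the two moduli is at least |b_i| / 2. *)
Lemma sum_subsets_ge N (b : 'I_N -> K) i :
  #|{set 'I_N}|%:R * modulus (b i) <=
  2 * \sum_(G : {set 'I_N}) modulus (\sum_(j in G) b j).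
Proof.
pose h (G : {set 'I_N}) : R := modulus (\sum_(j in G) b j).
pose flip (G : {set 'I_N}) := if i \in G then G :\ i else i |: G.
have flipK : involutive flip.
  move=> G; rewrite /flip; have [iG|iG] := boolP (i \in G).
    by rewrite finset.setD11 finset.setD1K.
  by rewrite finset.setU11 finset.setU1K.
have hflip G : modulus (b i) <= h G + h (flip G).
  have up (H : {set 'I_N}) : i \notin H -> modulus (b i) <= h H + h (i |: H).
    move=> iH; rewrite /h big_setU1//= -(modulusN (\sum_(j in H) b j)).
    by apply: le_trans (modulusD _ _); rewrite addrCA addNr addr0.
  rewrite /flip; case: ifPn => iG; last exact: up.
  by have := up (G :\ i); rewrite finset.setD11 finset.setD1K// addrC; apply.
have -> : 2 * \sum_G h G = \sum_G (h G + h (flip G)).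
  rewrite big_split /= [X in _ + X](_ : _ = \sum_G h G); last first.
    by rewrite [RHS](reindex flip)//; exists flip => ? _; exact: flipK.
  by rewrite mulrDl !mul1r.
by rewrite mulr_natl -sumr_const; apply: ler_sum.
Qed.

Context {d : measure_display} {T : measurableType d} (mu : {measure set T -> \bar R}).
Local Notation L1 := (L1 s mu).
Local Open Scope quotient_scope.

Lemma pi_L1_sum I (r : seq I) (P : pred I) (phi : I -> integrable_fun s mu) :
  \sum_(i <- r | P i) \pi_L1 (phi i) = \pi_L1 (\sum_(i <- r | P i) phi i) :> L1.
Proof.
apply/esym; apply: (big_morph (fun f => \pi_L1 f : L1)) => // f g.
by rewrite [RHS]pi_L1_add.
Qed.

Lemma integrable_sumE I (r : seq I) (P : pred I) (phi : I -> integrable_fun s mu) t :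
  (\sum_(i <- r | P i) phi i) t = \sum_(i <- r | P i) phi i t.
Proof. exact: (big_morph (fun f : integrable_fun s mu => f t : K)). Qed.

Lemma rnorm_L1 (x : L1) : (rnorm x)%:E = (\int[mu]_t (modulus (L1_fun x t))%:E)%E.
Proof.
rewrite /rnorm scal_realK fineK// integrable_fin_num//.
exact: integrable_modulus.
Qed.

Lemma rnorm_pi (f : integrable_fun s mu) :
  (rnorm (\pi_L1 f : L1))%:E = (\int[mu]_t (modulus (f t))%:E)%E.
Proof.
rewrite /rnorm scal_realK pi_L1_norm fineK// integrable_fin_num//.
exact: integrable_modulus.
Qed.

(** Integrate the inequality of [sum_subsets_ge] for b_j = F_j(t) over Q_i and sum
    over i: as the Q_i are disjoint, the right-hand sides add up to at most the
    integral over the whole space, that is, to a sum of norms of subset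
    sums. *)
Lemma sum_disjoint_integrals_le N (F : 'I_N -> L1) (Q : 'I_N -> set T) (M : R) :
  (forall j, measurable (Q j)) -> trivIset setT Q ->
  (forall G : {set 'I_N}, rnorm (\sum_(j in G) F j) <= M) ->
  (\sum_(j < N) \int[mu]_(t in Q j) (modulus (L1_fun (F j) t))%:E <= (2 * M)%:E)%E.
Proof.
move=> mQ tQ FM; set n : R := #|{set 'I_N}|%:R.
have n0 : 0 < n by rewrite ltr0n; apply/card_gt0P; exists finset.set0.
pose phi j : integrable_fun s mu := repr (F j).
pose S (G : {set 'I_N}) t : \bar R := (modulus (\sum_(j in G) phi j t))%:E.
have SE G : S G = fun t => (modulus ((\sum_(j in G) phi j) t))%:E.
  by apply/funext => t; rewrite integrable_sumE.
have mS G : measurable_fun setT (S G).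
  by rewrite SE; apply/measurable_EFinP/measurable_modulus.
have S0 G t : (0 <= S G t)%E by rewrite lee_fin modulus_ge0.
have SM G : (\int[mu]_t S G t <= M%:E)%E.
  rewrite SE -rnorm_pi -pi_L1_sum lee_fin; apply: le_trans (FM G).
  by rewrite (eq_bigr F)// => j _; rewrite /phi reprK.
pose H t := (2%:E * \sum_(G : {set 'I_N}) S G t)%E.
have mH : measurable_fun setT H.
  by apply: measurable_funeM; apply: emeasurable_sum => G; exact: mS.
have H0 t : (0 <= H t)%E by rewrite mule_ge0// sume_ge0.
have IH : (\int[mu]_t H t <= (n * (2 * M))%:E)%E.
  rewrite /H ge0_integralZl//; last 2 first.
  - by apply: emeasurable_sum => G; exact: mS.
  - by move=> t _; rewrite sume_ge0.
  rewrite ge0_integral_sum// mulrCA EFinM lee_pmul2l//.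
  apply: le_trans (lee_sum _ (fun G _ => SM G)) _.
  by rewrite sumEFin lee_fin sumr_const mulr_natl.
have key : (n%:E * \sum_(j < N) \int[mu]_(t in Q j) (modulus (phi j t))%:E <= \int[mu]_t H t)%E.
  have mphi j : measurable_fun setT (fun t => (modulus (phi j t))%:E).
    exact/measurable_EFinP/measurable_modulus.
  rewrite ge0_sume_distrr; last first.
    by move=> j _; apply: integral_ge0 => t _; rewrite lee_fin modulus_ge0.
  apply: (@le_trans _ _ (\sum_(j < N) \int[mu]_(t in Q j) H t)%E).
    apply: lee_sum => j _; rewrite -ge0_integralZl//.
    - apply: ge0_le_integral => //.
      + by move=> t _; rewrite mule_ge0// lee_fin ?modulus_ge0// ltW.
      + by apply: measurable_funeM; exact: measurable_funTS.
      + exact: measurable_funTS.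
      + move=> t _; rewrite /H /S -EFinM sumEFin -EFinM lee_fin.
        exact: sum_subsets_ge.
    - exact: measurable_funTS.
    - by move=> t _; rewrite lee_fin modulus_ge0.
    - by rewrite lee_fin ltW.
  rewrite -(@ge0_integral_bigsetU _ _ _ mu _ Q H (index_enum 'I_N))//.
  - apply: ge0_subset_integral => //.
    by apply: bigsetU_measurable.
  - exact: index_enum_uniq.
  - exact: sub_trivIset tQ.
  - exact: measurable_funTS.
rewrite -(@lee_pmul2l _ n%:E)// -EFinM; exact: le_trans key IH.
Qed.

End subset_sums.

(** * Translates by separated points *)

Section translates.
Context {R : realType} {s : scalars} (d : nat).
Local Notation K := (scal R s).
Local Notation mu := (lebesgue_rV d : {measure set 'rV[R]_d -> \bar R}).
Local Notation L1d := (L1 s mu).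
Implicit Types (f g : L1d) (a : 'rV[R]_d).

Lemma measurable_modulus_L1 f : measurable_fun setT (fun t => (modulus (L1_fun f t))%:E).
Proof. exact/measurable_EFinP/measurable_modulus. Qed.

Lemma measurable_preimage_translate a (Q : set 'rV[R]_d) : measurable Q ->
  measurable ((fun x => x - a) @^-1` Q).
Proof. by move=> mQ; rewrite -[X in measurable X]setTI; exact: measurable_addr_rV. Qed.

Lemma integral_translate_L1 f g a (Q : set 'rV[R]_d) : measurable Q ->
  ae_eq mu setT (L1_fun f) (translate a (L1_fun g)) ->
  (\int[mu]_(t in (fun x => x - a)%R @^-1` Q) (modulus (L1_fun f t))%:E =
   \int[mu]_(t in Q) (modulus (L1_fun g t))%:E)%E.
Proof.
move=> mQ fg; have mg := measurable_modulus_L1 g.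
have mQ' := measurable_preimage_translate a mQ.
rewrite -(ge0_integral_translate a mQ mg); last by move=> x; rewrite lee_fin modulus_ge0.
apply: ae_eq_integral => //.
- by apply: measurable_funTS; exact: measurable_modulus_L1.
- apply: measurable_funTS.
  exact: (measurableT_comp mg (measurable_addr_rV (- a))).
- by apply: filterS fg => t /= -> //.
Qed.

Lemma rnorm_translate f g a :
  ae_eq mu setT (L1_fun f) (translate a (L1_fun g)) -> rnorm f = rnorm g.
Proof.
move=> fg; apply: EFin_inj; rewrite !rnorm_L1.
by rewrite -(integral_translate_L1 measurableT fg) preimage_setT.
Qed.

Lemma L1_fun_scale (c : K) f :
  ae_eq mu setT (L1_fun (c *: f)) (fun t => c * L1_fun f t).
Proof. exact: (repr_L1 (c *: repr f)). Qed.

(** c is the mass of g on a set Q of diameter less than delta; the translates of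
    Q by delta-separated points are disjoint, and translation invariance makes
    the mass of each F_i on its translate of Q equal to c. *)
Lemma separated_translates_lower g (delta : R) : g != 0 -> 0 < delta ->
  exists2 c : R, 0 < c &
  forall N (F : 'I_N -> L1d) (lambda : 'I_N -> 'rV[R]_d) (b : 'I_N -> K) (M : R),
    (forall i j, i != j -> delta <= euclidean_norm (lambda i - lambda j)) ->
    (forall i, ae_eq mu setT (L1_fun (F i)) (translate (lambda i) (L1_fun g))) ->
    (forall G : {set 'I_N}, rnorm (\sum_(i in G) b i *: F i) <= M) ->
    c * \sum_(i < N) modulus (b i) <= 2 * M.
Proof.
move=> g0 delta0.
have [|||Q [mQ Qdiam Qpos]] := @positive_cell R d (fun t => modulus (L1_fun g t)) delta delta0.
- exact: measurable_modulus.
- by move=> t; exact: modulus_ge0.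
- by rewrite -rnorm_L1 eqe; apply: contra_neq g0; exact: rnorm_eq0.
set I := (\int[mu]_(x in Q) _)%E in Qpos.
have Ifin : I \is a fin_num.
  rewrite ge0_fin_numE ?(ltW Qpos)//.
  apply: (@le_lt_trans _ _ (rnorm g)%:E); last exact: ltry.
  rewrite rnorm_L1; apply: ge0_subset_integral => //.
    exact: measurable_modulus_L1.
  by move=> t _; rewrite lee_fin modulus_ge0.
exists (fine I); first by rewrite fine_gt0// Qpos -ge0_fin_numE ?(ltW Qpos).
move=> N F lambda b M sep Ftr FM.
pose Q' i := (fun x => x - lambda i) @^-1` Q.
have mQ' i : measurable (Q' i) by exact: measurable_preimage_translate.
have tQ' : trivIset setT Q'.
  apply/trivIsetP => i j _ _ ij; apply/seteqP; split=> // x [Qi Qj].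
  have := sep _ _ ij; rewrite leNgt => /negP; apply.
  by have := Qdiam _ _ Qj Qi; rewrite opprB addrC addrA subrK.
have := sum_disjoint_integrals_le mQ' tQ' FM.
rewrite (eq_bigr (fun i => (modulus (b i))%:E * I)%E); last first.
  move=> i _; rewrite /I -(integral_translate_L1 mQ (Ftr i)) -ge0_integralZl//.
  - apply: ae_eq_integral => //.
    + by apply: measurable_funTS; exact: measurable_modulus_L1.
    + by apply: measurable_funeM; by apply: measurable_funTS; exact: measurable_modulus_L1.
    + apply: filterS (L1_fun_scale (b i) (F i)) => t /= -> // _.
      by rewrite modulusM EFinM.
  - exact: mQ' i.
  - by apply: measurable_funTS; exact: measurable_modulus_L1.
  - by move=> t _; rewrite lee_fin modulus_ge0.
  - by rewrite lee_fin modulus_ge0.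
rewrite -(fineK Ifin); under eq_bigr do rewrite -EFinM.
by rewrite sumEFin lee_fin -mulr_suml mulrC.
Qed.

End translates.

(** * Completeness of L_1 *)

Section L1_complete.
Context {R : realType} {d : measure_display} {T : measurableType d}.
Variable mu : {measure set T -> \bar R}.

(** The series converges at every t where G is finite; the upper limit is a measurable
    function which is defined everywhere. *)
Lemma dominated_series_cvg (r : nat -> T -> R) (G : T -> \bar R) :
  (forall i, measurable_fun setT (r i)) -> mu.-integrable setT G ->
  (forall t n, (\sum_(i < n) `|r i t|)%:E <= G t)%E ->
  exists f : T -> R, mu.-integrable setT (EFin \o f) /\
    (fun n => \int[mu]_t (`|\sum_(i < n) r i t - f t|)%:E)%E @ \oo --> 0%E.
Proof.
move=> mr iG rG.
pose u n t : \bar R := (\sum_(i < n) r i t)%:E.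
have mu_ n : measurable_fun setT (u n).
  by apply/measurable_EFinP; apply: measurable_sum => i; exact: mr.
pose f t := fine (limn_esup (u ^~ t)).
have mf : measurable_fun setT (EFin \o f).
  apply/measurable_EFinP; apply: (measurableT_comp (fine_measurable measurableT)) => //.
  exact: measurable_fun_limn_esup.
have uf : {ae mu, forall t, setT t -> u ^~ t @ \oo --> (EFin \o f) t}.
  have := integrable_ae measurableT iG; apply: filterS => t /(_ Logic.I) Gt _.
  have /cvg_ex[l hl] : cvgn (fun n => \sum_(i < n) r i t : R^o).
    have /normed_cvg : cvgn [normed series (fun i => r i t : R^o)].
      apply: nondecreasing_is_cvgn.
        by apply: nondecreasing_series => n _ _; exact: normr_ge0.
      exists (fine (G t)) => _ [n _ <-].
      rewrite -lee_fin fineK// /= /series /= big_mkord; exact: rG.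
    by under [X in cvgn X -> _]eq_fun do rewrite /series /= big_mkord.
  have hu : u ^~ t @ \oo --> l%:E by apply: cvg_EFin; [exact: nearW|exact: hl].
  by rewrite /f /= is_cvg_limn_esupE; [rewrite (cvg_lim _ hu)|apply/cvg_ex; exists l%:E].
have uG : {ae mu, forall t n, setT t -> (`|u n t| <= G t)%E}.
  by apply: aeW => t n _; apply: le_trans (rG t n); rewrite /u abse_EFin lee_fin ler_norm_sum.
have [fi f0 _] := dominated_convergence measurableT mu_ mf uf iG uG.
exists f; split=> //.
Qed.

Section scalar.
Context {s : scalars}.
Local Notation K := (scal R s).
Local Notation L1 := (L1 s mu).
Local Open Scope quotient_scope.

Definition scal_mk (a b : R) : K :=
  match s return scal R s with
  | RealScalars => a
  | ComplexScalars => (a +i* b)%C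
  end.

Lemma scal_re_mk a b : scal_re (scal_mk a b) = a.
Proof. by rewrite /scal_re /scal_mk; case: s. Qed.

Lemma scal_im_mk_cases : (forall a b, scal_im (scal_mk a b) = 0) \/
  (forall a b, scal_im (scal_mk a b) = b).
Proof. by rewrite /scal_im /scal_mk; case: s; [left|right]. Qed.

(** For real scalars [scal_mk] forgets b, which is why only an inequality holds. *)
Lemma modulus_sub_mk_le (z : K) a b :
  modulus (z - scal_mk a b) <= `|scal_re z - a| + `|scal_im z - b|.
Proof.
have realE : `|scal_re z - a| <= `|scal_re z - a| + `|scal_im z - b| by rewrite lerDl.
move: z realE; rewrite /scal_mk; case: s => z h.
  by rewrite -rnorm_modulus /rnorm /=.
apply: (le_trans (modulus_le _)); rewrite scal_reD scal_imD.
by case: z {h} => u v.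
Qed.

Lemma abs_re_le (z : K) : `|scal_re z| <= modulus z.
Proof.
rewrite /modulus -sqrtr_sqr ler_wsqrtr// lerDl; exact: sqr_ge0.
Qed.

Lemma abs_im_le (z : K) : `|scal_im z| <= modulus z.
Proof.
rewrite /modulus -sqrtr_sqr ler_wsqrtr// lerDr; exact: sqr_ge0.
Qed.

Lemma scal_re_sum n (z : 'I_n -> K) : scal_re (\sum_i z i) = \sum_i scal_re (z i).
Proof. by apply: big_morph; [exact: scal_reD|exact: scal_re0]. Qed.

Lemma scal_im_sum n (z : 'I_n -> K) : scal_im (\sum_i z i) = \sum_i scal_im (z i).
Proof. by apply: big_morph; [exact: scal_imD|exact: scal_im0]. Qed.

(** The sum of the moduli is integrable by monotone convergence, and dominates
    the partial sums of the real and imaginary parts. *)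
Theorem L1_summable_complete : summable_complete L1.
Proof.
move=> x [M xM].
pose phi i : integrable_fun s mu := repr (x i).
pose G t := (\sum_(0 <= i <oo) (modulus (phi i t))%:E)%E.
have mphi i : measurable_fun setT (fun t => (modulus (phi i t))%:E).
  exact/measurable_EFinP/measurable_modulus.
have G0 t i : (0 <= (modulus (phi i t))%:E)%E by rewrite lee_fin modulus_ge0.
have iG : mu.-integrable setT G.
  apply/integrableP; split; first by apply: ge0_emeasurable_sum => // k t.
  under eq_integral => t _ do rewrite gee0_abs ?nneseries_ge0//.
  rewrite integral_nneseries//; apply: (@le_lt_trans _ _ M%:E); last exact: ltry.
  apply: lime_le; first by apply: is_cvg_nneseries => i _ _; exact: integral_ge0.
  apply: nearW => n; rewrite big_mkord.
  under eq_bigr do rewrite -rnorm_pi reprK.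
  by rewrite sumEFin lee_fin.
have domG (v : K -> R) (vle : forall z, `|v z| <= modulus z) t n :
    ((\sum_(i < n) `|v (phi i t)|)%:E <= G t)%E.
  apply: (@le_trans _ _ (\sum_(0 <= i < n) (modulus (phi i t))%:E)%E).
    by rewrite big_mkord sumEFin lee_fin; apply: ler_sum.
  exact: nneseries_lim_ge.
have mre i : measurable_fun setT (fun t => scal_re (phi i t)).
  by apply/measurable_EFinP; exact: measurable_int (integrable_funP (phi i)).1.
have mim i : measurable_fun setT (fun t => scal_im (phi i t)).
  by apply/measurable_EFinP; exact: measurable_int (integrable_funP (phi i)).2.
have [a [ia ca]] := dominated_series_cvg mre iG (domG _ abs_re_le).
have [b [ib cb]] := dominated_series_cvg mim iG (domG _ abs_im_le).
have hP : (fun t => scal_mk (a t) (b t) : K^o) \in @scal_integrable_pred d T R s mu.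
  apply/asboolP; split; first by under eq_fun do rewrite scal_re_mk.
  have [h|h] := scal_im_mk_cases; under eq_fun do rewrite h; last by [].
  exact: integrable0.
pose h : integrable_fun s mu := IntegrableFun hP.
have small (u : nat -> \bar R) (e : R) : 0 < e -> u @ \oo --> 0%E ->
    \forall n \near \oo, (u n < e%:E)%E.
  move=> e0 u0; apply: (u0 [set y | (y < e%:E)%E]).
  apply: open_nbhs_nbhs; split; first exact: open_ereal_lt_ereal.
  by rewrite /= lte_fin.
apply/cvg_ex; exists (\pi_L1 h); apply/cvg_rnormP => e e0.
have e2 : 0 < e / 2 by rewrite divr_gt0.
have [N1 _ h1] := small _ _ e2 ca; have [N2 _ h2] := small _ _ e2 cb.
exists (maxn N1 N2) => n; rewrite geq_max => /andP[/h1 /= {}h1 /h2 /= {}h2].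
rewrite rdistC; have -> : series x n - \pi_L1 h = \pi_L1 (\sum_(i < n) phi i - h).
  rewrite /series /= big_mkord (eq_bigr (fun i : 'I_n => \pi_L1 (phi i) : L1)).
    by rewrite pi_L1_sum -pi_L1_add -pi_L1_opp.
  by move=> i _; rewrite reprK.
have ms (v : K -> R) (c : T -> R) : (forall i, measurable_fun setT (fun t => v (phi i t))) ->
    mu.-integrable setT (EFin \o c) ->
    measurable_fun setT (fun t => (`|\sum_(i < n) v (phi i t) - c t|)%:E).
  move=> mv /measurable_int /measurable_EFinP mc; apply/measurable_EFinP.
  apply: measurableT_comp => //; apply: measurable_funB => //.
  exact: measurable_sum.
rewrite -lte_fin rnorm_pi [e]splitr EFinD.
apply: le_lt_trans (lteD h1 h2).
rewrite -ge0_integralD//; [|exact: ms|exact: ms].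
apply: ge0_le_integral => //.
- by move=> t _; rewrite lee_fin modulus_ge0.
- exact/measurable_EFinP/measurable_modulus.
- by apply: emeasurable_funD; exact: ms.
- move=> t _; rewrite -EFinD lee_fin -scal_re_sum -scal_im_sum -integrable_sumE.
  exact: modulus_sub_mk_le.
Qed.

End scalar.
End L1_complete.

(** * From frames to complemented subspaces of ell_1 *)

Section closed_subspace.
Context {R : realType} {s : scalars}.
Local Notation K := (scal R s).
Variable V : normedModType K.

Lemma subsp_val_sum (X : submodClosed V) I (r : seq I) (P : pred I) (x : I -> subsp X) :
  subsp_val (\sum_(i <- r | P i) x i) = \sum_(i <- r | P i) subsp_val (x i).
Proof. exact: (big_morph (@subsp_val _ _ X)). Qed.

Lemma closed_subsp_complete (X : submodClosed V) :
  summable_complete V -> closed [set` X] -> summable_complete (subsp X).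
Proof.
move=> Vc Xcl x [M xM].
have /cvg_ex[l hl] : cvgn (series (fun i => subsp_val (x i))) by apply: Vc; exists M.
have serE n : subsp_val (series x n) = series (fun i => subsp_val (x i)) n.
  exact: subsp_val_sum.
have Xl : l \in X.
  apply: (closed_cvg _ Xcl _ _ hl); apply: nearW => n /=; rewrite -serE.
  by case: (series x n).
apply/cvg_ex; exists (Subsp Xl); apply/cvg_rnormP => e e0.
have /cvg_rnormP /(_ _ e0) [N hN] := hl; exists N => n Nn.
by rewrite rnorm_subsp -[subsp_val _]/(l - subsp_val (series x n)) serE hN.
Qed.

(** The range of a projection, as a membership test. *)
Definition fixed_points (P : {linear V -> V}) : {pred V} := [pred v | P v == v].

Fact fixed_points_submod_closed (P : {linear V -> V}) : submod_closed (fixed_points P).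
Proof.
split=> [|a u v]; rewrite !inE ?linear0// => /eqP Pu /eqP Pv.
by rewrite linearP Pu Pv.
Qed.

HB.instance Definition _ (P : {linear V -> V}) :=
  GRing.isSubmodClosed.Build _ _ (fixed_points P) (fixed_points_submod_closed P).

End closed_subspace.

Section frames.
Context {R : realType} {s : scalars}.
Local Notation K := (scal R s).
Local Notation ell1 := (ell1 R s).

(** Uniform boundedness applied to the partial sums of the moduli. *)
Lemma analysis_op (X : normedModType K) (f' : nat -> {linear X -> K^o}) :
  summable_complete X -> (forall i, bounded_op (f' i)) ->
  (forall x, exists M : R, forall n, \sum_(i < n) modulus (f' i x) <= M) ->
  exists2 A : {linear X -> ell1}, bounded_op A & forall x i, A x i = f' i x.
Proof.
move=> Xc fb fx.
have [||||M M0 hM] := @uniform_boundedness R s X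
    (fun n x => \sum_(i < n) modulus (f' i x)) Xc.
- move=> n x y; rewrite -big_split; apply: ler_sum => i _.
  by rewrite linearD; exact: modulusD.
- move=> n a x; rewrite mulr_sumr; apply: eq_bigr => i _.
  by rewrite linearZ; exact: modulusM.
- elim=> [|n [M hM]]; first by exists 0 => x; rewrite big_ord0 mul0r.
  have /bounded_opP[M' _ hM'] := fb n; exists (M + M') => x.
  by rewrite big_ord_recr/= mulrDl lerD// -rnorm_modulus.
- exact: fx.
have memA x : (fun i => f' i x) \in @ell1_pred R s by exact: ell1_mem (hM^~ x).
pose A x : ell1 := Ell1 (memA x).
have lA : linear A by move=> a x y; apply: ell1_eq => i; rewrite /= linearP.
exists (pack_linear lA) => //; apply/bounded_opP; exists M => // x.
by apply: ell1_norm_le => n; exact: hM.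
Qed.

Lemma inverse_linear (U V : normedModType K) (f : {linear U -> V}) (g : V -> U) :
  cancel f g -> cancel g f -> linear g.
Proof.
by move=> fK gK a x y; apply: (can_inj fK); rewrite linearP !gK.
Qed.

(** B is the synthesis operator followed by the inverse of the frame
    operator. *)
Lemma frame_retraction (X : normedModType K) (f : nat -> X)
    (f' : nat -> {linear X -> K^o}) (M : R) :
  summable_complete X -> approximate_schauder_frame f f' -> 0 <= M ->
  (forall i, rnorm (f i) <= M) ->
  (forall x, exists M : R, forall n, \sum_(i < n) modulus (f' i x) <= M) ->
  exists (A : {linear X -> ell1}) (B : {linear ell1 -> X}),
    [/\ bounded_op A, bounded_op B, cancel A B & forall x i, A x i = f' i x].
Proof.
move=> Xc [fb [S [[_ [T [SK TK Tb]]] fS]]] M0 fM fx.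
have [A Ab AE] := analysis_op Xc fb fx.
have [Phi [Phib _ PhiE]] := ell1_column_op Xc M0 fM.
pose T' := pack_linear (inverse_linear SK TK).
exists A, (T' \o Phi); split=> //; first exact: bounded_op_comp.
move=> x; rewrite /= -[RHS]SK; congr T.
have -> : S x = limn (series (fun i => f' i x *: f i)).
  by apply/esym/cvg_lim; [exact: norm_hausdorff|exact: fS].
rewrite (_ : (fun i => _) = fun i => A x i *: f i).
  by apply/esym/cvg_lim; [exact: norm_hausdorff|exact: PhiE].
by apply/funext => i; rewrite AE.
Qed.

End frames.

Section coefficients.
Context {R : realType} {s : scalars} (d : nat).
Local Notation K := (scal R s).
Local Notation mu := (lebesgue_rV d : {measure set 'rV[R]_d -> \bar R}).
Local Notation L1d := (L1 s mu).

(** Each index i is given a pair of a separated class containing it and a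
    generator of f_i; on each of the finitely many classes of pairs the lower
    estimate for separated translates applies to the tail, whose subset sums
    have norm less than 1. *)
Lemma unconditional_coefficients (X : submodClosed L1d) (f : nat -> subsp X)
    (lambda : nat -> 'rV[R]_d) (a : nat -> K) :
  translates_of_finite_family (subsp_val \o f) lambda ->
  relatively_uniformly_separated lambda ->
  unconditionally_convergent (fun i => a i *: f i) ->
  exists M : R, forall n, \sum_(i < n) modulus (a i) <= M.
Proof.
move=> [k0 [g [_ g0 /choice[k_ hk]]]] [m [Delta [Dcov _ Dsep]]] auc.
have /choice[l_ hl] i : exists l, Delta l i.
  have : (\bigcup_l Delta l) i by rewrite Dcov.
  by move=> [l _ li]; exists l.
have /choice[c hc] : forall p : 'I_m * 'I_k0, exists c : R, 0 < c /\
    forall N (F : 'I_N -> L1d) (la : 'I_N -> 'rV[R]_d) (b : 'I_N -> K) (M : R),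
    (forall i j, i != j -> exists i' j', [/\ i' != j', Delta p.1 i', Delta p.1 j',
       la i = lambda i' & la j = lambda j']) ->
    (forall i, ae_eq mu setT (L1_fun (F i)) (translate (la i) (L1_fun (g p.2)))) ->
    (forall G : {set 'I_N}, rnorm (\sum_(i in G) b i *: F i) <= M) ->
    c * \sum_(i < N) modulus (b i) <= 2 * M.
  move=> [l k]; have [delta delta0 hdelta] := Dsep l.
  have [c c0 hc] := separated_translates_lower (g0 k) delta0.
  exists c; split=> // N F la b M sep; apply: hc => i j /sep[i' [j' [ij Di Dj -> ->]]].
  exact: hdelta.
have [n0 hn0] := unconditional_small_tails auc (@ltr01 R).
exists (\sum_(i < n0) modulus (a i) + \sum_p 2 / c p) => n.
have pos u : 0 <= modulus (a u) by exact: modulus_ge0.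
apply: (@le_trans _ _ (\sum_(0 <= i < maxn n n0) modulus (a i))).
  rewrite -(big_mkord xpredT (fun i => modulus (a i))).
  by rewrite [leRHS](big_cat_nat (n := n)) ?leq_maxl//= lerDl sumr_ge0.
rewrite (big_cat_nat (n := n0)) ?leq_maxr//= big_mkord lerD2l.
rewrite (partition_big (fun i => (l_ i, k_ i)) xpredT) //=; apply: ler_sum => p _.
have [c0 hcp] := hc p; rewrite ler_pdivlMr// mulrC.
rewrite -big_filter; set r := [seq _ <- _ | _].
have ur : uniq r by rewrite filter_uniq// iota_uniq.
have rP i : i \in r -> (n0 <= i)%N /\ (l_ i, k_ i) = p.
  by rewrite mem_filter mem_index_iota => /andP[/eqP -> /andP[-> _]].
rewrite (big_nth 0%N) big_mkord.
have rn (j : 'I_(size r)) : nth 0%N r j \in r by rewrite mem_nth.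
rewrite -[leRHS]mulr1; apply: (hcp _ (fun j => subsp_val (f (nth 0%N r j)))
    (fun j => lambda (nth 0%N r j))) => [i j ij|j|G].
- exists (nth 0%N r i), (nth 0%N r j); have [_ ei] := rP _ (rn i); have [_ ej] := rP _ (rn j).
  by split=> //; [rewrite nth_uniq|rewrite -ei; exact: hl|rewrite -ej; exact: hl].
- by have [_ <-] := rP _ (rn j); exact: hk.
have := hn0 [seq nth 0%N r (val j) | j <- enum G].
rewrite map_inj_in_uniq ?enum_uniq; last first.
  move=> i j _ _ /eqP; rewrite nth_uniq ?ltn_ord//.
  by move=> /eqP /val_inj.
move=> /(_ isT); rewrite big_map big_enum /= rnorm_subsp subsp_val_sum => h.
apply/ltW/h => _ /mapP[j _ ->]; by have [] := rP _ (rn j).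
Qed.

End coefficients.

Theorem proposition4p9 (R : realType) (s : scalars) (d : nat)
    (X : submodClosed (L1 s (lebesgue_rV d : {measure set 'rV[R]_d -> \bar R})))
    (f : nat -> subsp X) (f' : nat -> {linear subsp X -> (scal R s)^o})
    (lambda : nat -> 'rV[R]_d)
    (d_gt0 : (0 < d)%N)
    (X_closed : closed [set` X])
    (X_infinite : infinite_dimensional (subsp X))
    (f_frame : unconditional_approximate_schauder_frame f f')
    (f_translates : translates_of_finite_family (subsp_val \o f) lambda)
    (lambda_separated : relatively_uniformly_separated lambda) :
  (exists (Y : submodClosed (ell1 R s)) (Psi : {linear subsp X -> subsp Y}),
    [/\ complemented Y, isomorphism Psi &
        forall g i, subsp_val (Psi g) i = f' i g]) /\
  (exists T : {linear subsp X -> ell1 R s}, isomorphism T).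
Proof.
have [fr fu] := f_frame.
have Xc : summable_complete (subsp X).
  exact: closed_subsp_complete (@L1_summable_complete _ _ _ _ _) X_closed.
have [M M0 fM] : exists2 M : R, 0 <= M & forall i, rnorm (f i) <= M.
  have [k0 [g [_ _ fg]]] := f_translates; exists (\sum_k rnorm (g k)).
    by apply: sumr_ge0 => k _; exact: rnorm_ge0.
  move=> i; have [k /rnorm_translate fgk] := fg i.
  rewrite rnorm_subsp fgk (bigD1 k)//= lerDl.
  by apply: sumr_ge0 => j _; exact: rnorm_ge0.
have [A [B [Ab Bb AK AE]]] := frame_retraction Xc fr M0 fM
  (fun x => unconditional_coefficients f_translates lambda_separated (fu x)).
split; last first.
  have [C [D [Cb Db CK]]] := ell1_complemented_copy Ab Bb AK X_infinite Xc.
  exact: ell1_decomposition Ab Bb Cb Db AK CK.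
pose P : {linear ell1 R s -> ell1 R s} := A \o B.
pose Y : submodClosed (ell1 R s) := fixed_points P.
have AY x : A x \in Y by rewrite inE /= AK.
pose Psi x : subsp Y := Subsp (AY x).
have lPsi : linear Psi by move=> a x y; apply/val_inj; rewrite /= linearP.
exists Y, (pack_linear lPsi); split=> [||g i]; last exact: AE.
- exists P; split; first exact: bounded_op_comp.
    by move=> a; exact: AY.
  by move=> a /eqP.
- split.
    by have /bounded_opP[N N0 hN] := Ab; apply/bounded_opP; exists N.
  exists (fun y => B (subsp_val y)); split=> [x|[y Yy]|].
  + exact: AK.
  + by apply/val_inj => /=; apply/eqP.
  + by have /bounded_opP[N N0 hN] := Bb; apply/bounded_opP; exists N => // y; exact: hN.
Qed.
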